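(* A non-zero Brownian displacement limit and finite ordinary instantaneous unresolved kinetic energy cannot both be retained as the correlation time $\tau_c\to0$. The white-noise model is a displacement-transport limit, not a finite-energy instantaneous-velocity limit.
   Context: The white-noise model is the stochastic particle map $\mathrm d\bm x_t=\bm u\,\mathrm dt+\bm\alpha\,\mathrm dW_t$ with resolved drift $\bm u$, displacement volatility $\bm\alpha$ and scalar standard Brownian motion $W_t$. Its finite-correlation precursor replaces the white-noise displacement by an unresolved velocity $\bm q^\tau=\bm\alpha\,\xi_t^\tau$ with correlation time $\tau_c>0$, where $\xi^\tau$ is the scalar Ornstein–Uhlenbeck process $$\mathrm d\xi_t^\tau=-\tau_c^{-1}\xi_t^\tau\,\mathrm dt+\tau_c^{-1}\,\mathrm dW_t .$$ It satisfies $\int_0^t\xi_s^\tau\,\mathrm ds=W_t-\tau_c(\xi_t^\tau-\xi_0^\tau)$, so the integrated velocity converges in mean square, as $\tau_c\to0$, to the Brownian displacement $\bm\alpha W_t$ (the Brownian displacement limit). The ordinary instantaneous unresolved kinetic energy, for density $\rho$, is $\mathbb E[\rho|\bm q^\tau|^2/2]$; at stationarity $\mathbb E(\bm q^\tau\otimes\bm q^\tau)=\bm\alpha\otimes\bm\alpha/(2\tau_c)$ and $\mathbb E[\rho|\bm q^\tau|^2/2]=\rho|\bm\alpha|^2/(4\tau_c)$. *)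

(* Defs.v *)
From HB Require Import structures.
From mathcomp Require Import all_boot all_order all_algebra.
From mathcomp Require Import all_classical all_reals all_analysis.

Set Implicit Arguments.
Unset Strict Implicit.
Unset Printing Implicit Defensive.

Import Order.TTheory GRing.Theory Num.Theory.
Import numFieldNormedType.Exports.

Local Open Scope classical_set_scope.
Local Open Scope ring_scope.

(* Processes are indexed by all of R; only the times t >= 0 are constrained. *)

Section processes.
Context {R : realType} {d : measure_display} {T : measurableType d}.
Variable P : probability T R.
Implicit Types (X : R -> {RV P >-> R}) (D : set R).

Definition sigma_process X D : set (set T) :=
  <<s [set A | exists t B, [/\ D t, measurable B & A = X t @^-1` B]] >>.

Definition indep_of (Z : T -> R) (F : set (set T)) : Prop :=
  forall (B : set R) (A : set T), measurable B -> F A ->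
    P (Z @^-1` B `&` A) = (P (Z @^-1` B) * P A)%E.

Definition as_continuous X : Prop :=
  {ae P, forall w, {within `[0, +oo[, continuous (fun t => X t w)}}.

(* The second parameter of [normal_prob] is the standard deviation. *)
Definition standard_brownian_motion (W : R -> {RV P >-> R}) : Prop :=
  [/\ {ae P, forall w, W 0 w = 0},
      forall s t, 0 <= s -> s <= t ->
        indep_of (fun w => W t w - W s w) (sigma_process W `[0, s]),
      forall s t, 0 <= s -> s < t -> forall B : set R, measurable B ->
        P ((fun w => W t w - W s w) @^-1` B)
          = normal_prob 0 (Num.sqrt (t - s)) B
    & as_continuous W].

(* d xi = - tau^-1 xi dt + tau^-1 dW in integral form.  The noise is additive,
   so the Ito integral of the constant tau^-1 is tau^-1 (W_t - W_0).  The
   initial value has an arbitrary law, independent of the driving noise. *)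
Definition ornstein_uhlenbeck (tau : R) (W X : R -> {RV P >-> R}) : Prop :=
  [/\ indep_of (X 0) (sigma_process W `[0, +oo[),
      as_continuous X
    & {ae P, forall w, forall t, 0 <= t ->
        X t w = X 0 w
          - tau^-1 * Rintegral lebesgue_measure `[0, t] (fun s => X s w)
          + tau^-1 * (W t w - W 0 w)}].

(* Strict stationarity: the finite-dimensional laws are shift invariant
   (measurable rectangles determine these laws). *)
Definition stationary X : Prop :=
  forall (k : nat) (t : 'I_k -> R) (B : 'I_k -> set R) (h : R),
    0 <= h -> (forall i, 0 <= t i) -> (forall i, measurable (B i)) ->
    P [set w | forall i, B i (X (t i + h) w)]
      = P [set w | forall i, B i (X (t i) w)].

End processes.

Section energy_and_displacement.
Context {R : realType} {d : measure_display} {T : measurableType d}.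
Variables (P : probability T R) (n : nat).
(* q tau t w is the unresolved velocity, with correlation time tau. *)
Implicit Types (q : R -> R -> T -> 'rV[R]_n) (alpha : 'rV[R]_n).
Implicit Types (W : R -> {RV P >-> R}).

(* Squared Euclidean norm; `|u| on matrices is the sup norm. *)
Definition sqnorm (u : 'rV[R]_n) : R := \sum_(i < n) u 0 i ^+ 2.

Definition unresolved_velocity alpha (xi : R -> R -> {RV P >-> R})
    (tau t : R) (w : T) : 'rV[R]_n :=
  xi tau t w *: alpha.

Definition integrated_velocity q (tau t : R) (w : T) : 'rV[R]_n :=
  \row_(i < n) Rintegral lebesgue_measure `[0, t] (fun s => q tau s w 0 i).

Definition brownian_displacement alpha W (t : R) (w : T) : 'rV[R]_n :=
  W t w *: alpha.

Definition brownian_displacement_limit alpha W q : Prop :=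
  forall t, 0 <= t ->
    ('E_P[fun w => sqnorm (integrated_velocity q tau t w
                           - brownian_displacement alpha W t w)%R]
      @[tau --> (0 : R)^'+] --> 0%:E)%E.

Definition nonzero_brownian_displacement alpha W : Prop :=
  exists2 t, 0 <= t & ~ {ae P, forall w, brownian_displacement alpha W t w = 0}.

Definition kinetic_energy (rho : R) q (tau t : R) : \bar R :=
  ('E_P[fun w => (rho * sqnorm (q tau t w) / 2)%R])%E.

Definition finite_energy_limit (rho : R) q (t : R) : Prop :=
  exists M : R, \forall tau \near (0 : R)^'+,
    (kinetic_energy rho q tau t <= M%:E)%E.

End energy_and_displacement.

(* Main.v *)
Require Import Defs.
From HB Require Import structures.
From mathcomp Require Import all_boot all_order all_algebra.
From mathcomp Require Import all_classical all_reals all_analysis.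
From mathcomp Require Import measurable_realfun ring lra.

(* All moments come from second-moment algebra. The law of the increments gives
   E(W_t - W_s)^2 = t - s, hence all Brownian covariances by polarization.
   Variation of constants writes X_t = e^{-(t-s)/tau} X_s + G_{s,t} with
   G_{s,t} = (W_t - W_s)/tau - tau^-2 int_s^t e^{-(t-r)/tau} (W_r - W_s) dr, and
   Riemann sums with Fatou's lemma bound the mean square of the time integral.
   Lower bound: the pairing of X_t with Y = W_t - W_{t-tau/2} sees only G_{s,t} and
   is at least 1/4, so E X_t^2 >= 1/(8 tau), whatever the initial law.
   Upper bound: X_{n tau} = e^{-n} X_0 + H_n with E H_n^2 <= 16/tau; for a stationary
   process the truncated second moments of X_{n tau} and X_0 agree, and n -> oo gives
   E X_0^2 <= 32/tau without assuming it finite.  Since the integrated velocity minus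
   W_t is -tau (X_t - X_0), the displacement error is O(tau). *)

Import Order.TTheory GRing.Theory Num.Theory.
Import numFieldNormedType.Exports.

Local Open Scope classical_set_scope.
Local Open Scope ring_scope.

Set Implicit Arguments.
Unset Strict Implicit.
Unset Printing Implicit Defensive.

(** * Path integrals: uniform continuity, Riemann sums, variation of constants *)

Section path_integrals.
Context {R : realType}.
Implicit Types (f : R -> R) (a b : R).
Notation mu := (@lebesgue_measure R).

(** Heine-Cantor in filter form: compactness of the segment turns a property valid near each point
    into one valid uniformly in the point. *)
Lemma segment_unif_continuous f a b :
  {within `[a, b], continuous f} -> forall e, 0 < e ->
  \forall d \near 0^'+, forall x y : R, x \in `[a, b] -> y \in `[a, b] ->
    `|x - y| < d -> `|f x - f y| < e.
Proof.
move=> cf e e0.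
have /compact_near_coveringP/near_covering_withinP cov := @segment_compact R a b.
pose P (d x : R) := forall y, y \in `[a, b] -> `|x - y| < d -> `|f x - f y| < e.
suff : \forall d \near (0 : R)^'+, `[a, b] `<=` P d.
  by apply: filterS => d dP x y xab yab xyd; exact: dP.
apply: cov => x xab.
have /subspace_continuousP/(_ x xab) := cf.
move=> /cvgrPdist_lt/(_ (e / 2) (divr_gt0 e0 (ltr0n _ 2))).
rewrite near_withinE => /nbhs_ballP[r /= r0 xr].
(* A point within r/2 of x and another within r/2 of that point both lie in the r-ball of x, so
   their values differ by less than e/2 + e/2. *)
exists (ball x (r / 2), [set d | d < r / 2]) => /=.
  split; first by apply: nbhsx_ballx; rewrite divr_gt0.
  by apply: nbhs_right_lt; rewrite divr_gt0.
move=> [x' d]/= [xx' dr] x'ab y yab x'yd.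
have H1 : `|f x - f x'| < e / 2.
  apply: xr => //; apply: le_ball xx'; lra.
have H2 : `|f x - f y| < e / 2.
  apply: xr => //; rewrite /ball/= (_ : x - y = (x - x') + (x' - y)); last by ring.
  rewrite (le_lt_trans (ler_normD _ _))//.
  by rewrite /ball/= in xx'; lra.
rewrite (_ : f x' - f y = (f x - f y) - (f x - f x')); last by ring.
by rewrite (le_lt_trans (ler_normB _ _))//; lra.
Qed.

(** Left endpoints on [n.+1] equal pieces, so that no index divides by zero. *)
Definition riemann_sum (a b : R) (n : nat) (f : R -> R) :=
  (b - a) / n.+1%:R * \sum_(k < n.+1) f (a + (b - a) * k%:R / n.+1%:R).

Lemma continuous_FTC1_within f a b : a < b -> {within `[a, b], continuous f} ->
  let F x := Rintegral mu `[a, x] f in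
  {within `[a, b], continuous F} /\
  forall x, x \in `]a, b[ -> is_derive x 1 F (f x).
Proof.
move=> ab cf F.
have fi : mu.-integrable `[a, b] (EFin \o f).
  by apply: continuous_compact_integrable => //; exact: segment_compact.
split; first by apply: parameterized_integral_continuous => //; exact: ltW.
move=> x /[dup] xab; rewrite in_itv/= => /andP[ax xb].
have H := continuous_FTC1_closed xb fi ax
  (within_continuous_continuous ab cf xab).
have [dF F'] : derivable F x 1 /\ derive1 F x = f x := H.
move: dF F'; clearbody F => dF F'.
by have := derivableP dF; rewrite -derive1E F'.
Qed.

(** The mean value theorem for the primitive [F] gives the exact increment h f(c) on each piece;
    uniform continuity replaces f(c) by the left-endpoint value at cost e / (b - a), for a total of
    e. *)
Lemma riemann_sum_cvg f a b : a < b -> {within `[a, b], continuous f} ->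
  riemann_sum a b n f @[n --> \oo] --> Rintegral mu `[a, b] f.
Proof.
move=> ab cf; pose F (x : R) := Rintegral mu `[a, x] f.
have [cF dF] : {within `[a, b], continuous F} /\
    forall x : R, x \in `]a, b[ -> is_derive x 1 F (f x).
  exact: continuous_FTC1_within.
apply/cvgrPdist_le => e e0.
have e'0 : 0 < e / (b - a) by rewrite divr_gt0// subr_gt0.
near (0 : R)^'+ => d.
have d0 : 0 < d by near: d; exact: nbhs_right_gt.
have dP : forall x y : R, x \in `[a, b] -> y \in `[a, b] ->
    `|x - y| < d -> `|f x - f y| < e / (b - a).
  by near: d; exact: segment_unif_continuous.
near=> n.
pose t (k : nat) : R := a + (b - a) * k%:R / n.+1%:R.
pose h := (b - a) / n.+1%:R.
have h0 : 0 < h by rewrite divr_gt0// subr_gt0.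
have tS k : t k.+1 = t k + h by rewrite /t /h -natr1; ring.
have t0 : t 0 = a by rewrite /t mulr0 mul0r addr0.
have tn : t n.+1 = b by rewrite /t mulfK ?pnatr_eq0// addrC subrK.
have tab k : (k <= n.+1)%N -> a <= t k <= b.
  move=> kn; rewrite -{1}t0 -tn /t !lerD2l !ler_pM2r ?invr_gt0// !ler_pM2l ?subr_gt0//.
  by rewrite !ler_nat kn.
have hd : h < d.
  rewrite /h ltr_pdivrMr// mulrC -ltr_pdivrMr//.
  rewrite (@lt_le_trans _ _ n%:R) ?ler_nat//.
  by near: n; exact: nbhs_infty_gtr.
have FE : Rintegral mu `[a, b] f = \sum_(k < n.+1) (F (t k.+1) - F (t k)).
  rewrite -(big_mkord xpredT (fun k => F (t k.+1) - F (t k))).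
  by rewrite (telescope_sumr (F \o t))//= t0 tn {2}/F set_itv1 Rintegral_set1 subr0.
clearbody F; rewrite FE /riemann_sum mulr_sumr -sumrB.
rewrite (le_trans (ler_norm_sum _ _ _))//.
rewrite (@le_trans _ _ (\sum_(k < n.+1) e / n.+1%:R))//; last first.
  by rewrite sumr_const card_ord -[leLHS]mulr_natr divfK// pnatr_eq0.
apply: ler_sum => k _.
have /andP[ak _] : a <= t k <= b by apply: tab; rewrite ltnW.
have /andP[_ kb] : a <= t k.+1 <= b by exact: tab.
have tk : t k < t k.+1 by rewrite tS ltrDl.
have dFk (x : R) : x \in `]t k, t k.+1[ -> is_derive x 1 F (f x).
  rewrite in_itv/= => /andP[tx xt]; apply: dF; rewrite in_itv/=.
  by rewrite (le_lt_trans ak)// (lt_le_trans xt).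
have cFk : {within `[t k, t k.+1], continuous F}.
  apply: continuous_subspaceW cF => x/=; rewrite !in_itv/= => /andP[tx xt].
  by rewrite (le_trans ak)// (le_trans xt).
have [c] := MVT tk dFk cFk.
rewrite in_itv/= => /andP[tc ct] ->; rewrite {1}tS addrAC subrr add0r mulrC -/h.
rewrite -mulrBr normrM (ger0_norm (ltW h0)).
have cd : `|c - t k| < d.
  by rewrite ger0_norm ?subr_ge0 1?ltW//; rewrite tS in ct; lra.
have := dP c (t k); rewrite !in_itv/= ak (le_trans ak (ltW tc)).
rewrite (le_trans (ltW ct) kb) (le_trans (ltW tk) kb) => /(_ isT isT cd) fc.
rewrite (le_trans (ler_wpM2l (ltW h0) (ltW fc)))//.
by rewrite /h mulrAC [X in X / _]mulrC divfK// subr_eq0 gt_eqF.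
Unshelve. all: end_near. Qed.
(* With I the primitive of x, the function e^{(r-t)/tau} (I_r - tau x_s) of r has
   derivative e^{(r-t)/tau} (w_r - w_s) / tau. *)
Lemma variation_of_constants (tau s t : R) (x w : R -> R) : tau != 0 -> s < t ->
  {within `[s, t], continuous x} -> {within `[s, t], continuous w} ->
  (forall r, r \in `[s, t] ->
    x r = x s - tau^-1 * Rintegral mu `[s, r] x + tau^-1 * (w r - w s)) ->
  x t = expR ((s - t) / tau) * x s + tau^-1 * (w t - w s)
    - tau ^- 2 * Rintegral mu `[s, t] (fun r => expR ((r - t) / tau) * (w r - w s)).
Proof.
move=> tau0 st cx cw xE; pose I (r : R) := Rintegral mu `[s, r] x.
have [cI dI] : {within `[s, t], continuous I} /\
    forall r : R, r \in `]s, t[ -> is_derive r 1 I (x r).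
  exact: continuous_FTC1_within.
have {}xE (r : R) : r \in `[s, t] -> x r = x s - tau^-1 * I r + tau^-1 * (w r - w s).
  exact: xE.
have Is : I s = 0 by rewrite /I set_itv1 Rintegral_set1.
clearbody I.
pose E (r : R) : R := expR ((r - t) / tau).
have dE (r : R) : is_derive r 1 E (tau^-1 * E r).
  have d1 : is_derive r 1 ((id - cst t) * cst tau^-1 : R -> R) tau^-1.
    by apply: is_derive_eq; rewrite /cst/= scaler0 add0r subr0 scaler1.
  have d2 := @is_derive1_comp R expR ((id - cst t) * cst tau^-1) r _ _
    (is_derive_expR _) d1.
  exact: (is_derive_eq d2 (mulrC _ _)).
have cE : continuous E.
  move=> r; apply: differentiable_continuous; apply/derivable1_diffP.
  by have [] := dE r.
have Et : E t = 1 by rewrite /E subrr mul0r expR0.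
have -> : (fun r => expR ((r - t) / tau) * (w r - w s)) = (fun r => E r * (w r - w s)).
  by [].
rewrite -[expR _]/(E s).
clearbody E.
pose G : R -> R := cst tau * (E * (I - cst (tau * x s))).
have dG (r : R) : r \in `]s, t[ -> is_derive r 1 G (E r * (w r - w s)).
  move=> rst; have dIr := dI _ rst; have dEr := dE r.
  apply: is_derive_eq.
  rewrite !fctE /GRing.scale/= xE; last first.
    by move: rst; rewrite !in_itv/= => /andP[/ltW -> /ltW ->].
  by field.
have cG : {within `[s, t], continuous G}.
  move=> r; apply: cvgM; first exact: cvg_cst.
  apply: cvgM; first exact: (continuous_subspaceT cE).
  by apply: cvgB; [exact: cI|exact: cvg_cst].
have [cG1 cG2 cG3] := (continuous_within_itvP G st).1 cG.
have cf : {within `[s, t], continuous (fun r => E r * (w r - w s))}.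
  move=> r; apply: cvgM; first exact: (continuous_subspaceT cE).
  by apply: cvgB; [exact: cw|exact: cvg_cst].
have FTC : Rintegral mu `[s, t] (fun r => E r * (w r - w s)) = G t - G s.
  rewrite /Rintegral (continuous_FTC2 st cf (F := G))//.
    by split => // r rst; have [] := dG r rst.
  by move=> r rst; rewrite derive1E; have [_] := dG r rst.
(* At the endpoints G_t = tau (I_t - tau x_s) and G_s = - tau^2 E_s x_s; the equation at t then
   eliminates I_t. *)
rewrite FTC /G !fctE Is Et xE; last by rewrite in_itv/= lexx ltW.
by field.
Qed.
End path_integrals.

(** * Symmetry and second moment of the centred normal law *)

Section normal_moments.
Context {R : realType}.
Notation mu := (@lebesgue_measure R).
Local Notation pdf s := (normal_pdf (0 : R) s).

(** Change of variables holds for the abstract Radon-Nikodym derivative, which equals [normal_pdf]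
    almost everywhere because both have the same integral over every measurable set. *)
Lemma ge0_integral_normal_prob (m s : R) (f : R -> \bar R) :
  (forall x, 0 <= f x)%E -> measurable_fun setT f ->
  (\int[normal_prob m s]_x f x = \int[mu]_x (f x * (normal_pdf m s x)%:E))%E.
Proof.
move=> f0 mf.
have dom := normal_prob_dominates m s.
rewrite -(Radon_Nikodym_SigmaFinite.change_of_variables dom)//.
set D := Radon_Nikodym_SigmaFinite.f _ _.
have iD : mu.-integrable setT D by exact: Radon_Nikodym_SigmaFinite.f_integrable.
have mD : measurable_fun setT D by exact: measurable_int iD.
have mp : measurable_fun setT (fun x : R => (normal_pdf m s x)%:E).
  by apply/measurable_EFinP; exact: measurable_normal_pdf.
apply: ge0_ae_eq_integral => //.
- exact: emeasurable_funM.
- exact: emeasurable_funM.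
- by move=> x _; rewrite mule_ge0// Radon_Nikodym_SigmaFinite.f_ge0.
- by move=> x _; rewrite mule_ge0// lee_fin normal_pdf_ge0.
apply: ae_eqe_mul2l; apply: integral_ae_eq => //.
by move=> E _ mE; rewrite -Radon_Nikodym_SigmaFinite.f_integral.
Qed.

(** Splitting at 0 and reflecting the negative half-line turns both sides into the same two
    half-line integrals, in opposite order. *)
Lemma ge0_integralT_oppr (f : R -> R) : (forall x, 0 <= f x) -> continuous f ->
  (\int[mu]_x (f x)%:E = \int[mu]_x (f (- x))%:E)%E.
Proof.
have half (g : R -> R) : (forall x, 0 <= g x) -> continuous g ->
  (\int[mu]_x (g x)%:E = \int[mu]_(x in `[0%R, +oo[) (g x)%:E +
     \int[mu]_(x in `[0%R, +oo[) (g (- x)%R)%:E)%E.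
  move=> g0 cg.
  have mg : measurable_fun [set: R] (EFin \o g).
    by apply/measurable_EFinP; exact: continuous_measurable_fun.
  rewrite -(setUv `[0%R, +oo[) ge0_integral_setU//=; last 4 first.
    exact: measurableC.
    by rewrite setUv.
    by move=> x _; rewrite lee_fin.
    exact/disj_setPCl.
  congr +%E; rewrite setCitvr integral_itv_bndo_bndc; last exact: measurable_funTS.
  rewrite -{1}oppr0 ge0_integration_by_substitutionNy//.
  exact: continuous_subspaceT.
move=> f0 cf; rewrite half// [RHS]half//; last 1 first.
  by move=> x; apply: continuous_comp; [exact: opp_continuous|exact: cf].
by rewrite addeC; congr +%E; apply: eq_integral => x _; rewrite opprK.
Qed.

(** Evenness of the density. Comparing the two parts separately avoids any integrability question;
    the zero mean follows from it later. *)
Lemma normal_prob_symmetric_parts (s : R) : s != 0 ->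
  (\int[normal_prob 0%R s]_x (Num.max x 0)%:E =
   \int[normal_prob 0%R s]_x (Num.max (- x) 0)%:E)%E.
Proof.
move=> s0.
have cmax : continuous (fun x : R => Num.max x 0).
  by move=> x; apply: continuous_max; [exact: cvg_id|exact: cvg_cst].
have cmaxN : continuous (fun x : R => Num.max (- x) 0).
  by move=> x; apply: continuous_max; [exact: opp_continuous|exact: cvg_cst].
rewrite !ge0_integral_normal_prob//; last 4 first.
- by move=> x; rewrite lee_fin le_max lexx orbT.
- by apply/measurable_EFinP; exact: continuous_measurable_fun.
- by move=> x; rewrite lee_fin le_max lexx orbT.
- by apply/measurable_EFinP; exact: continuous_measurable_fun.
under eq_integral do rewrite -EFinM.
rewrite (@ge0_integralT_oppr (fun x => Num.max x 0 * pdf s x)); last 2 first.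
- by move=> x; rewrite mulr_ge0 ?normal_pdf_ge0// le_max lexx orbT.
- by move=> x; apply: cvgM; [exact: cmax|exact: continuous_normal_pdf].
apply: eq_integral => x _; rewrite -EFinM; congr (_ * _)%:E.
by rewrite normal_pdfE// /normal_fun !subr0 sqrrN.
Qed.

Lemma is_derive_normal_pdf0 (s x : R) : s != 0 ->
  is_derive x 1 (pdf s) (- (x / s ^+ 2) * pdf s x).
Proof.
move=> s0; rewrite normal_pdfE//.
pose u : R -> R := (- ((id - cst 0) ^+ 2)) * cst (s ^+ 2 *+ 2)^-1.
have du : is_derive x 1 u (- (x / s ^+ 2)).
  apply: is_derive_eq; rewrite !fctE /GRing.scale/=.
  by field.
have dE := @is_derive1_comp R expR u x _ _ (is_derive_expR _) du.
have -> : (fun y => normal_peak s * normal_fun 0 s y) = cst (normal_peak s) * (expR \o u).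
  by [].
apply: is_derive_eq; rewrite !fctE /GRing.scale/=.
by rewrite /normal_fun; ring.
Qed.

(** This is the boundary term in the integration by parts for the second moment. *)
Lemma cvgn_mul_normal_pdf0 (s : R) : s != 0 ->
  n%:R * pdf s n%:R @[n --> \oo] --> (0 : R).
Proof.
move=> s0; rewrite normal_pdfE//.
have s2 : 0 < s ^+ 2 by rewrite exprn_even_gt0.
(* Since e^y >= y at y = n^2 / (2 s^2), the term is at most peak * 2 s^2 / n; the final doubling
   uses n + 1 <= 2 n to reach the harmonic sequence. *)
apply: (@squeeze_cvgr _ _ _ _ (cst 0)
  (fun n : nat => normal_peak s * (s ^+ 2 *+ 2) * n.+1%:R^-1 *+ 2)); last 2 first.
- exact: cvg_cst.
- rewrite -[X in _ --> X](mul0rn _ 2) -[X in _ --> X *+ 2](mulr0 (normal_peak s * (s ^+ 2 *+ 2))).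
  by apply: cvgMn; apply: cvgMr; exact: cvg_harmonic.
near=> n.
have n0 : 0 < n%:R :> R by rewrite ltr0n; near: n; exact: nbhs_infty_gt.
rewrite mulr_ge0//= ?mulr_ge0 ?normal_peak_ge0 ?normal_fun_ge0//=.
rewrite mulrCA -mulrA -mulrnAr ler_wpM2l ?normal_peak_ge0//.
rewrite /normal_fun subr0 mulNr expRN ler_pdivrMr ?expR_gt0//.
rewrite (@le_trans _ _ (s ^+ 2 *+ 2 / n.+1%:R *+ 2 * (n%:R ^+ 2 / (s ^+ 2 *+ 2))))//.
  rewrite -mulrnAl mulrAC [_ * (_ / _)]mulrA.
  have N0 : n.+1%:R != 0 :> R by rewrite pnatr_eq0.
  rewrite [leRHS](_ : _ = 2 * n%:R ^+ 2 / n.+1%:R); last first.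
    move: N0; move: (n.+1%:R) => N N0; by field; rewrite N0 s0.
  rewrite ler_pdivlMr ?ltr0n// expr2 -natr1.
  have : 1 <= n%:R :> R by rewrite ler1n -(ltr0n R).
  nra.
rewrite ler_wpM2l//; first by rewrite mulrn_wge0// divr_ge0// mulrn_wge0// ltW.
by rewrite (le_trans _ (expR_ge1Dx _))// lerDr.
Unshelve. all: end_near. Qed.


Lemma integral_normal_pdf0_ge0 (s : R) : s != 0 ->
  (\int[mu]_(x in `[0%R, +oo[) (pdf s x)%:E = 2^-1%:E)%E.
Proof.
move=> s0; have even : pdf s =1 pdf s \o -%R.
  by move=> x; rewrite normal_pdfE//= /normal_fun !subr0 sqrrN.
have := ge0_symfun_integralT (normal_pdf_ge0 0 s) (continuous_normal_pdf s0) even.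
rewrite integral_normal_pdf -set_itvcy => /esym H.
have {H} := congr1 (fun z => 2^-1%:E * z)%E H.
by rewrite muleA -EFinM mulVf// mul1e mule1.
Qed.

(** Integration by parts on [0, n]: with p the density, p' = - (x / s^2) p, so - s^2 x p has
    derivative x^2 p - s^2 p. As n grows the boundary term vanishes and the half-line carries mass
    1/2. *)
Lemma integral_sqr_normal_pdf0_ge0 (s : R) : s != 0 ->
  (\int[mu]_(x in `[0%R, +oo[) (x ^+ 2 * pdf s x)%:E = (s ^+ 2 / 2)%:E)%E.
Proof.
move=> s0; have cp := continuous_normal_pdf s0 (m := 0).
have p0 := normal_pdf_ge0 (0 : R) s.
pose q (x : R) := x ^+ 2 * pdf s x.
have cq : continuous q.
  by move=> x; apply: cvgM; [exact: sqr_continuous|exact: cp].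
have q0 x : 0 <= q x by rewrite mulr_ge0// sqr_ge0.
have int f n : continuous f -> mu.-integrable `[0, n] (EFin \o f).
  move=> cf; apply: continuous_compact_integrable; first exact: segment_compact.
  exact: continuous_subspaceT.
have parts (n : nat) : (0 < n)%N ->
    (\int[mu]_(x in `[0%R, n%:R]) (q x)%:E =
     (s ^+ 2)%:E * \int[mu]_(x in `[0%R, n%:R]) (pdf s x)%:E
       - (s ^+ 2 * (n%:R * pdf s n%:R))%:E)%E.
  move=> n0.
  pose F : R -> R := cst (- s ^+ 2) * (id * pdf s).
  have dF (x : R) : is_derive x 1 F (q x - s ^+ 2 * pdf s x).
    have dp := is_derive_normal_pdf0 x s0.
    by apply: is_derive_eq; rewrite !fctE /GRing.scale/= /q; field.
  have cF : continuous F.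
    by move=> x; apply: differentiable_continuous; apply/derivable1_diffP; have [] := dF x.
  have n0R : 0 < n%:R :> R by rewrite ltr0n.
  have cqp : continuous (fun x => q x - s ^+ 2 * pdf s x).
    by move=> x; apply: cvgB; [exact: cq|apply: cvgMr; exact: cp].
  have LR : derivable_oo_LRcontinuous F 0 n%:R.
    split; [by move=> x _; have [] := dF x|exact/cvg_at_right_filter/cF|
      exact/cvg_at_left_filter/cF].
  have F' : {in `]0, n%:R[, derive1 F =1 fun x => q x - s ^+ 2 * pdf s x}.
    by move=> x _; rewrite derive1E; have [_] := dF x.
  have := continuous_FTC2 n0R (continuous_subspaceT cqp) LR F'.
  have iq := int q n%:R cq; have ip := int (pdf s) n%:R cp.
  under eq_integral do rewrite EFinB [(s ^+ 2 * _)%:E]EFinM.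
  rewrite integralB//; last exact: (integrableZl _ (s ^+ 2) ip).
  rewrite integralZl// -(fineK (integrable_fin_num _ iq))//.
  rewrite -(fineK (integrable_fin_num _ ip))// -!EFinM -!EFinB => -[].
  by rewrite /F !fctE mul0r mulr0 subr0 => /eqP; rewrite subr_eq => /eqP ->; congr EFin; ring.
have cvgq := @ge0_cvgn_integral _ mu _ q0 (continuous_measurable_fun cq).
have cvgp := @ge0_cvgn_integral _ mu _ p0 (measurable_normal_pdf 0 s).
rewrite integral_normal_pdf0_ge0// in cvgp.
have cvgr : (((s ^+ 2)%:E * \int[mu]_(x in `[0%R, n%:R]) (pdf s x)%:E
       - (s ^+ 2 * (n%:R * pdf s n%:R))%:E) @[n --> \oo] -->
    (s ^+ 2)%:E * 2^-1%:E - (s ^+ 2 * 0)%:E)%E.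
  apply: cvgeB => //; first exact: cvgeZl.
  by apply: cvg_EFin; [exact: nearW|apply: cvgMr; exact: cvgn_mul_normal_pdf0].
rewrite mulr0 sube0 -EFinM in cvgr.
rewrite -(cvg_lim _ cvgq)//; apply/cvg_lim => //; apply: cvg_trans cvgr.
apply: near_eq_cvg; near=> n; rewrite parts//; near: n; exact: nbhs_infty_gt.
Unshelve. all: end_near. Qed.

Lemma normal_prob_second_moment (s : R) : s != 0 ->
  (\int[normal_prob 0%R s]_x (x ^+ 2)%:E = (s ^+ 2)%:E)%E.
Proof.
move=> s0; rewrite ge0_integral_normal_prob//; last 2 first.
- by move=> x; rewrite lee_fin sqr_ge0.
- by apply/measurable_EFinP; exact: exprn_measurable.
under eq_integral do rewrite -EFinM.
rewrite (@ge0_symfun_integralT _ (fun x => x ^+ 2 * pdf s x)).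
- by rewrite -set_itvcy integral_sqr_normal_pdf0_ge0// -EFinM mulrC divfK.
- by move=> x; rewrite mulr_ge0 ?sqr_ge0 ?normal_pdf_ge0.
- by move=> x; apply: cvgM; [exact: sqr_continuous|exact: continuous_normal_pdf].
- by move=> x; rewrite normal_pdfE//= /normal_fun !subr0 !sqrrN.
Qed.

End normal_moments.

(** * Second-moment algebra and mean-square bounds for time integrals *)

Section second_moments.
Context {d : measure_display} {T : measurableType d} {R : realType}.
Variable P : probability T R.
Implicit Types X Y Z : T -> R.

Lemma Lfun2P X : X \in Lfun P 2%:E <->
  measurable_fun setT X /\ (\int[P]_w (X w ^+ 2)%:E < +oo)%E.
Proof.
split=> [X2|[mX X2]].
  split; first by have /andP[+ _] := X2; rewrite inE.
  have /integrableP[_] := Lfun2_integrable_sqr X2; apply: le_lt_trans.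
  apply: ge0_le_integral => //.
  - by move=> w _; rewrite lee_fin sqr_ge0.
  - have /andP[+ _] := X2; rewrite inE => mX.
    by apply/measurable_EFinP; exact: measurable_funX.
  - have /integrableP[mX _] := Lfun2_integrable_sqr X2.
    exact: measurableT_comp.
  - by move=> w _; rewrite /= ger0_norm ?sqr_ge0.
rewrite inE; apply/andP; split; first by rewrite inE.
rewrite inE/= /finite_norm unlock /Lnorm poweR_lty//.
rewrite (eq_integral (fun w => (X w ^+ 2)%:E))// => w _.
by rewrite -[LHS]/((`|X w| `^ 2%:R)%:E) powR_mulrn// real_normK ?num_real.
Qed.

(** The inner product of L2, taken real-valued so that [ring] and [lra] apply. An infinite integral
    would be sent to 0, hence the square-integrability hypotheses below. *)
Definition mixed_moment X Y : R := \int[P]_w (X w * Y w).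

Lemma mixed_momentC X Y : mixed_moment X Y = mixed_moment Y X.
Proof. by apply: eq_Rintegral => w _; rewrite mulrC. Qed.

Lemma Lfun2_integrableM X Y : X \in Lfun P 2%:E -> Y \in Lfun P 2%:E ->
  P.-integrable setT (EFin \o (X \* Y)).
Proof. by move=> X2 Y2; apply/Lfun1_integrable/Lfun2_mul_Lfun1. Qed.

Lemma mixed_momentDl X Y Z :
    X \in Lfun P 2%:E -> Y \in Lfun P 2%:E -> Z \in Lfun P 2%:E ->
  mixed_moment (X + Y) Z = mixed_moment X Z + mixed_moment Y Z.
Proof.
move=> X2 Y2 Z2; rewrite /mixed_moment -RintegralD//; try exact: Lfun2_integrableM.
by apply: eq_Rintegral => w _; rewrite mulrDl.
Qed.

Lemma mixed_momentZl a X Y : X \in Lfun P 2%:E -> Y \in Lfun P 2%:E ->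
  mixed_moment (a *: X) Y = a * mixed_moment X Y.
Proof.
move=> X2 Y2; rewrite /mixed_moment -RintegralZl//; last exact: Lfun2_integrableM.
by apply: eq_Rintegral => w _; rewrite /= -mulrA.
Qed.

Lemma Lfun2D X Y : X \in Lfun P 2%:E -> Y \in Lfun P 2%:E -> X + Y \in Lfun P 2%:E.
Proof. by move=> X2 Y2; rewrite rpredD// lee_fin ler1n. Qed.

Lemma Lfun2Z a X : X \in Lfun P 2%:E -> a *: X \in Lfun P 2%:E.
Proof. by move=> X2; rewrite rpredZ// lee_fin ler1n. Qed.

Lemma Lfun2N X : X \in Lfun P 2%:E -> - X \in Lfun P 2%:E.
Proof. by rewrite -scaleN1r; exact: Lfun2Z. Qed.

Lemma Lfun2B X Y : X \in Lfun P 2%:E -> Y \in Lfun P 2%:E -> X - Y \in Lfun P 2%:E.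
Proof. by move=> X2 Y2; apply: Lfun2D => //; exact: Lfun2N. Qed.

Lemma mixed_momentBl X Y Z :
    X \in Lfun P 2%:E -> Y \in Lfun P 2%:E -> Z \in Lfun P 2%:E ->
  mixed_moment (X - Y) Z = mixed_moment X Z - mixed_moment Y Z.
Proof.
move=> X2 Y2 Z2; rewrite mixed_momentDl// ?Lfun2N// -scaleN1r mixed_momentZl//.
by rewrite mulN1r.
Qed.

Lemma second_momentE X : X \in Lfun P 2%:E ->
  (\int[P]_w (X w ^+ 2)%:E = (mixed_moment X X)%:E)%E.
Proof.
move=> X2; rewrite /mixed_moment fineK; last first.
  exact: integrable_fin_num (Lfun2_integrableM X2 X2).
by apply: eq_integral => w _; rewrite -expr2.
Qed.

Lemma second_moment_le X (c : R) : X \in Lfun P 2%:E ->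
  (\int[P]_w (X w ^+ 2)%:E <= c%:E)%E = (mixed_moment X X <= c).
Proof. by move=> X2; rewrite second_momentE// lee_fin. Qed.

Lemma mixed_moment_ge0 X : 0 <= mixed_moment X X.
Proof. by apply: Rintegral_ge0 => w _; rewrite -expr2 sqr_ge0. Qed.

Lemma ae_eq_mixed_moment X X' Y :
    X \in Lfun P 2%:E -> X' \in Lfun P 2%:E -> Y \in Lfun P 2%:E ->
  {ae P, forall w, X w = X' w} -> mixed_moment X Y = mixed_moment X' Y.
Proof.
move=> X2 X'2 Y2 XX'; congr fine; apply: ae_eq_integral => //.
- exact: measurable_int (Lfun2_integrableM X2 Y2).
- exact: measurable_int (Lfun2_integrableM X'2 Y2).
by apply: filterS XX' => w /= -> _.
Qed.

Lemma mixed_moment_sqrD X Y : X \in Lfun P 2%:E -> Y \in Lfun P 2%:E ->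
  mixed_moment (X + Y) (X + Y) =
  mixed_moment X X + mixed_moment X Y *+ 2 + mixed_moment Y Y.
Proof.
move=> X2 Y2; have XY2 := Lfun2D X2 Y2.
rewrite mixed_momentDl// mixed_momentC [mixed_moment Y _]mixed_momentC.
by rewrite !mixed_momentDl// [mixed_moment Y X]mixed_momentC; ring.
Qed.

Lemma mixed_moment_sqrB X Y : X \in Lfun P 2%:E -> Y \in Lfun P 2%:E ->
  mixed_moment (X - Y) (X - Y) =
  mixed_moment X X - mixed_moment X Y *+ 2 + mixed_moment Y Y.
Proof.
move=> X2 Y2; have XY2 := Lfun2B X2 Y2.
rewrite mixed_momentBl// mixed_momentC [mixed_moment Y _]mixed_momentC.
by rewrite !mixed_momentBl// [mixed_moment Y X]mixed_momentC; ring.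
Qed.

(** Cauchy-Schwarz against the constant sequence 1. *)
Lemma sqr_sum_le (n : nat) (x : nat -> R) :
  (\sum_(k < n) x k) ^+ 2 <= n%:R * \sum_(k < n) x k ^+ 2.
Proof.
elim: n => [|[|n] IH]; first by rewrite !big_ord0 expr0n mul0r.
  by rewrite !big_ord1 mul1r.
rewrite big_ord_recr/= [in leRHS]big_ord_recr/= -[n.+2%:R]natr1.
move: IH; set S := \sum_(k < n.+1) x k; set Q := \sum_(k < n.+1) x k ^+ 2.
have n1 : 0 < n.+1%:R :> R by [].
move: n1 S Q (x n.+1) => /=; move: (n.+1%:R) => N N0 S Q y SQ.
(* After multiplication by N, the cross term is controlled by (S - N y)^2 >= 0 and the induction
   hypothesis S^2 <= N Q. *)
suff : 2 * S * y <= Q + N * y ^+ 2 by nra.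
rewrite -(ler_pM2l N0); have : 0 <= (S - N * y) ^+ 2 by exact: sqr_ge0.
by nra.
Qed.

Lemma limn_einf_ge0 (u : (\bar R)^nat) : (forall n, 0 <= u n)%E ->
  (0 <= limn_einf u)%E.
Proof.
move=> u0; rewrite limn_einf_lim; apply: lime_ge; first exact: is_cvg_einfs.
by apply: nearW => n; apply: le_ereal_inf_tmp => _ [k _ <-].
Qed.

Lemma limn_einf_le (u : (\bar R)^nat) (M : \bar R) : (forall n, u n <= M)%E ->
  (limn_einf u <= M)%E.
Proof.
move=> uM; rewrite limn_einf_lim; apply: lime_le; first exact: is_cvg_einfs.
apply: nearW => n; apply: le_trans (uM n).
by apply: ereal_inf_lbound; exists n => /=.
Qed.

(** Convergence holds only almost surely, so g is first exchanged under the integral for the lower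
    limit, to which Fatou's lemma applies. *)
Lemma ae_fatou_le (f : (T -> \bar R)^nat) (g : T -> \bar R) (M : \bar R) :
  (forall n, measurable_fun setT (f n)) -> measurable_fun setT g ->
  (forall n w, 0 <= f n w)%E -> (forall w, 0 <= g w)%E ->
  {ae P, forall w, f n w @[n --> \oo] --> g w} ->
  (forall n, \int[P]_w f n w <= M)%E -> (\int[P]_w g w <= M)%E.
Proof.
move=> mf mg f0 g0 fg fM.
have -> : (\int[P]_w g w = \int[P]_w limn_einf (f ^~ w))%E.
  apply: ge0_ae_eq_integral => //.
  - apply: measurableT_comp => //; apply: measurable_fun_limn_esup => n.
    exact: measurableT_comp.
  - by move=> w _; exact: limn_einf_ge0.
  by apply: filterS fg => w /cvg_limn_einf_sup[-> _].
apply: le_trans (fatou _ _ _ _) _ => //; exact: limn_einf_le.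
Qed.

(** Riemann sums take the place of Fubini's theorem because measurability is given only at each
    fixed time. Each sum obeys the bound by Cauchy-Schwarz, and Fatou's lemma passes it to [J]. *)
Lemma mean_square_Rintegral (X : R -> T -> R) (J : T -> R) (a b C : R) :
  a < b -> (forall r, r \in `[a, b] -> measurable_fun setT (X r)) ->
  measurable_fun setT J ->
  (forall r, r \in `[a, b] -> (\int[P]_w (X r w ^+ 2)%:E <= C%:E)%E) ->
  {ae P, forall w, {within `[a, b], continuous (fun r => X r w)} /\
    J w = Rintegral lebesgue_measure `[a, b] (fun r => X r w)} ->
  (\int[P]_w (J w ^+ 2)%:E <= ((b - a) ^+ 2 * C)%:E)%E.
Proof.
move=> ab mX mJ XC XJ.
pose t n (k : nat) : R := a + (b - a) * k%:R / n.+1%:R.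
have tab n (k : 'I_n.+1) : t n k \in `[a, b].
  have ba : 0 <= b - a by rewrite subr_ge0 ltW.
  rewrite in_itv/= /t lerDl divr_ge0 ?mulr_ge0//=.
  rewrite -lerBrDl ler_pdivrMr ?ltr0n// ler_wpM2l//.
  by rewrite ler_nat ltnW.
pose S n w := riemann_sum a b n (fun r => X r w).
have mS n : measurable_fun setT (S n).
  apply: measurable_funM => //; apply: measurable_sum => k; exact/mX/tab.
have mS2 n : measurable_fun setT (fun w => (S n w ^+ 2)%:E).
  by apply/measurable_EFinP; exact: measurable_funX.
have SC n : (\int[P]_w (S n w ^+ 2)%:E <= ((b - a) ^+ 2 * C)%:E)%E.
  (* The squared mesh times the factor n + 1 from Cauchy-Schwarz. *)
  pose c := (b - a) ^+ 2 / n.+1%:R.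
  have c0 : 0 <= c by rewrite divr_ge0// sqr_ge0.
  apply: (@le_trans _ _ (\int[P]_w (c%:E * \sum_(k < n.+1) (X (t n k) w ^+ 2)%:E))%E).
    apply: ge0_le_integral => //.
    - by move=> w _; rewrite lee_fin sqr_ge0.
    - apply: measurable_funeM; apply: emeasurable_sum => k.
      by apply/measurable_EFinP/measurable_funX; exact/mX/tab.
    - move=> w _; rewrite sumEFin -EFinM lee_fin /S /riemann_sum exprMn.
      apply: le_trans (ler_wpM2l (sqr_ge0 _) (sqr_sum_le n.+1 (fun k => X (t n k) w))) _.
      by rewrite mulrA ler_wpM2r ?sumr_ge0// => [k _|]; rewrite ?sqr_ge0// expr_div_n
        [X in _ / X]expr2 invfM mulrA divfK// pnatr_eq0.
  rewrite ge0_integralZl//; last 2 first.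
    apply: emeasurable_sum => k.
    by apply/measurable_EFinP/measurable_funX; exact/mX/tab.
    by move=> w _; rewrite sume_ge0// => k _; rewrite lee_fin sqr_ge0.
  rewrite ge0_integral_sum//; last 2 first.
    by move=> k; apply/measurable_EFinP/measurable_funX; exact/mX/tab.
    by move=> k w _; rewrite lee_fin sqr_ge0.
  apply: (@le_trans _ _ (c%:E * \sum_(k < n.+1) C%:E)%E).
    by rewrite lee_wpmul2l ?lee_fin//; apply: lee_sum => k _; exact/XC/tab.
  rewrite sumEFin -EFinM lee_fin sumr_const card_ord -[C *+ _]mulr_natr.
  by rewrite /c mulrCA divfK ?pnatr_eq0// mulrC.
apply: (ae_fatou_le mS2 _ _ _ _ SC).
- by apply/measurable_EFinP; exact: measurable_funX.
- by move=> n w; rewrite lee_fin sqr_ge0.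
- by move=> w; rewrite lee_fin sqr_ge0.
apply: filterS XJ => w [cX ->].
apply: cvg_EFin; first exact: nearW.
apply: (cvg_comp (fun n => S n w) (fun x : R => x ^+ 2)); last exact: sqr_continuous.
exact: riemann_sum_cvg.
Qed.

End second_moments.

(** * Moments of independent variables and of variables with a normal law *)

Section independence_and_gaussians.
Context {d : measure_display} {T : measurableType d} {R : realType}.
Variable P : probability T R.

(** Factorization on rectangles identifies the joint law with the product of the marginals; Fubini's
    theorem, integrating y first, leaves x E Y = 0. *)
Lemma independent_mixed_moment_eq0 (X Y : {RV P >-> R}) :
  (X : T -> R) \in Lfun P 2%:E -> (Y : T -> R) \in Lfun P 2%:E ->
  (forall A B : set R, measurable A -> measurable B ->
    P (X @^-1` A `&` Y @^-1` B) = (P (X @^-1` A) * P (Y @^-1` B))%E) ->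
  (\int[P]_w (Y w)%:E = 0)%E -> mixed_moment P X Y = 0.
Proof.
move=> X2 Y2 XY Y0.
pose h w := (X w, Y w).
have mh : measurable_fun setT h by exact: measurable_fun_pair.
pose H : {RV P >-> (R * R)%type} := HB.pack h (isMeasurableFun.Build _ _ _ _ h mh).
pose f (z : R * R) := (z.1 * z.2)%:E.
have mf : measurable_fun setT f by apply/measurable_EFinP; exact: measurable_funM.
have iXY : P.-integrable setT (f \o H) by exact: Lfun2_integrableM.
have prodE (A : set (R * R)) : measurable A ->
    (distribution P X \x distribution P Y)%E A = distribution P H A.
  apply: product_measure_unique => A1 B1 mA1 mB1; rewrite /distribution/= /pushforward.
  by rewrite -XY.
have i2 : (distribution P X \x distribution P Y)%E.-integrable setT f.
  apply/integrableP; split => //.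
  rewrite (eq_measure_integral (distribution P H)); last by move=> A mA _; exact: prodE.
  by have /integrableP[] := integrable_pushforward mh mf iXY measurableT.
have -> : mixed_moment P X Y = fine (\int[distribution P H]_z f z)%E.
  by congr fine; rewrite integral_distribution.
rewrite -(eq_measure_integral _ (m1 := (distribution P X \x distribution P Y)%E)); last first.
  by move=> A mA _; exact: prodE.
rewrite -(integral12_prod_meas1 i2)// integral0_eq// => x _.
have iY : P.-integrable setT (EFin \o Y).
  apply/Lfun1_integrable; apply: Lfun_subset12 => //; exact: fin_num_measure.
transitivity (\int[distribution P Y]_y (x%:E * (EFin y)))%E.
  by apply: eq_integral => y _; rewrite /f EFinM.
have iYd : (distribution P Y).-integrable setT (@EFin R).
  by apply: integrable_pushforward => //; exact: EFin_measurable_fun.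
by rewrite integralZl// integral_distribution// Y0 mule0.
Qed.

Section normal_law.
Variables (Z : T -> R) (s : R).
Hypotheses (s0 : s != 0) (mZ : measurable_fun setT Z).
Hypothesis ZE : forall B : set R, measurable B -> P (Z @^-1` B) = normal_prob 0 s B.

(* The type [measurableTypeR R] and the canonical measurable structure of [R]
   have convertible sigma-algebras but distinct displays. *)
Lemma ge0_integral_normal_law (f : R -> \bar R) : measurable_fun [set: R] f ->
  (forall x, 0 <= f x)%E ->
  (\int[P]_w f (Z w) = \int[normal_prob 0%R s]_x f x)%E.
Proof.
move=> mf f0; pose Z' : T -> measurableTypeR R := Z.
have mZ' : measurable_fun setT Z' := mZ.
have mf' : measurable_fun [set: measurableTypeR R] f := mf.
transitivity (\int[pushforward P Z']_x f x)%E.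
  by rewrite ge0_integral_pushforward.
apply: (@eq_measure_integral _ _ _ _ (normal_prob 0 s) (pushforward P Z')) => A mA _.
exact: ZE.
Qed.

Lemma normal_law_second_moment : (\int[P]_w (Z w ^+ 2)%:E = (s ^+ 2)%:E)%E.
Proof.
rewrite -normal_prob_second_moment//.
rewrite (ge0_integral_normal_law (f := fun x => (x ^+ 2)%:E))//.
  by apply/measurable_EFinP; exact: exprn_measurable.
by move=> x; rewrite lee_fin sqr_ge0.
Qed.

Lemma normal_law_Lfun2 : Z \in Lfun P 2%:E.
Proof. by apply/Lfun2P; rewrite normal_law_second_moment ltry. Qed.

(** The positive and negative parts have equal integrals by symmetry, and these are finite because
    L2 is contained in L1, so they cancel. *)
Lemma normal_law_mean : (\int[P]_w (Z w)%:E = 0)%E.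
Proof.
have iZ : P.-integrable setT (EFin \o Z).
  apply/Lfun1_integrable; apply: Lfun_subset12 normal_law_Lfun2.
  exact: fin_num_measure.
have mmax (h : R -> R) : continuous h -> measurable_fun [set: R] (fun x => (Num.max (h x) 0)%:E).
  move=> ch; apply/measurable_EFinP; apply: continuous_measurable_fun => x.
  by apply: continuous_max; [exact: ch|exact: cvg_cst].
rewrite integralE.
have -> : (\int[P]_w (EFin \o Z)^\+ w)%E = (\int[P]_w (Num.max (Z w) 0)%:E)%E.
  by apply: eq_integral => w _; rewrite funeposE EFin_max.
have -> : (\int[P]_w (EFin \o Z)^\- w)%E = (\int[P]_w (Num.max (- Z w) 0)%:E)%E.
  by apply: eq_integral => w _; rewrite funenegE EFin_max.
rewrite (ge0_integral_normal_law (f := fun x => (Num.max x 0)%:E)); last 2 first.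
- by apply: mmax => x; exact: cvg_id.
- by move=> x; rewrite lee_fin le_max lexx orbT.
rewrite (ge0_integral_normal_law (f := fun x => (Num.max (- x) 0)%:E)); last 2 first.
- by apply: mmax => x; exact: opp_continuous.
- by move=> x; rewrite lee_fin le_max lexx orbT.
rewrite -normal_prob_symmetric_parts// subee//.
rewrite -(ge0_integral_normal_law (f := fun x => (Num.max x 0)%:E)); last 2 first.
- by apply: mmax => x; exact: cvg_id.
- by move=> x; rewrite lee_fin le_max lexx orbT.
have := integrable_funepos measurableT iZ => /integrable_fin_num.
rewrite (eq_integral (fun w => (Num.max (Z w) 0)%:E)); first exact.
by move=> w _; rewrite funeposE EFin_max.
Qed.

End normal_law.
End independence_and_gaussians.

(** * Time integrals in L2 and their pairing with a fixed variable *)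

Section mean_square_integral.
Context {d : measure_display} {T : measurableType d} {R : realType}.
Variable P : probability T R.
Local Notation M := (mixed_moment P).

(** The parallelogram identity with the square of X - Y dropped. *)
Lemma mixed_moment_sqrD_le (X Y : T -> R) :
  X \in Lfun P 2%:E -> Y \in Lfun P 2%:E ->
  M (X + Y) (X + Y) <= 2 * M X X + 2 * M Y Y.
Proof.
move=> X2 Y2; have := mixed_moment_ge0 P (X - Y).
by rewrite mixed_moment_sqrB// mixed_moment_sqrD//; lra.
Qed.

Lemma mixed_moment0l (X : T -> R) : M 0 X = 0.
Proof.
transitivity (\int[P]_w (cst 0 w : R)); last by rewrite Rintegral_cst// mul0r.
by apply: eq_Rintegral => w _; rewrite mul0r.
Qed.

Lemma mixed_momentZZ a (X : T -> R) : X \in Lfun P 2%:E ->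
  M (a *: X) (a *: X) = a ^+ 2 * M X X.
Proof.
move=> X2; have aX2 := Lfun2Z a X2.
by rewrite mixed_momentZl// mixed_momentC mixed_momentZl// mulrA expr2.
Qed.

Section time_integral.
Variables (X : R -> T -> R) (J : T -> R) (a b C : R).
Hypotheses (ab : a < b) (X2 : forall r, r \in `[a, b] -> X r \in Lfun P 2%:E).
Hypothesis XC : forall r, r \in `[a, b] -> M (X r) (X r) <= C.
Hypothesis JX : {ae P, forall w, {within `[a, b], continuous (fun r => X r w)} /\
  J w = Rintegral lebesgue_measure `[a, b] (fun r => X r w)}.

Lemma Rintegral_Lfun2 : measurable_fun setT J -> J \in Lfun P 2%:E.
Proof.
move=> mJ; apply/Lfun2P; split => //.
apply: le_lt_trans (ltry ((b - a) ^+ 2 * C)).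
apply: mean_square_Rintegral JX => // r rab; first by have [] := (Lfun2P _ _).1 (X2 rab).
by rewrite second_moment_le; [exact: XC|exact: X2].
Qed.

Lemma Rintegral_second_moment_le : J \in Lfun P 2%:E -> M J J <= (b - a) ^+ 2 * C.
Proof.
move=> J2; rewrite -second_moment_le//.
apply: mean_square_Rintegral JX => //; last 2 first.
- by have [] := (Lfun2P _ _).1 J2.
- by move=> r rab; rewrite second_moment_le; [exact: XC|exact: X2].
by move=> r rab; have [] := (Lfun2P _ _).1 (X2 rab).
Qed.

End time_integral.

(* Applied to X_r + l Y, the second moment bound is quadratic in l with the same
   l^2 terms on both sides; letting l tend to infinity compares the linear terms. *)
Lemma Rintegral_mixed_moment_le (X : R -> T -> R) (J Y : T -> R) (a b C c : R) :
  a < b -> (forall r, r \in `[a, b] -> X r \in Lfun P 2%:E) ->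
  (forall r, r \in `[a, b] -> M (X r) (X r) <= C) ->
  {ae P, forall w, {within `[a, b], continuous (fun r => X r w)} /\
    J w = Rintegral lebesgue_measure `[a, b] (fun r => X r w)} ->
  J \in Lfun P 2%:E -> Y \in Lfun P 2%:E ->
  (forall r, r \in `[a, b] -> M (X r) Y <= c) -> M J Y <= (b - a) * c.
Proof.
move=> ab X2 XC JX J2 Y2 XY.
have ba : 0 < b - a by rewrite subr_gt0.
have C0 : 0 <= C.
  by apply: le_trans (XC a _); [exact: mixed_moment_ge0|rewrite in_itv/= lexx ltW].
have key l : 0 <= l -> 2 * l * M J Y <= (b - a) * (C + 2 * l * c).
  move=> l0; have lY2 := Lfun2Z l Y2; have blY2 := Lfun2Z ((b - a) * l) Y2.
  have X'2 r : r \in `[a, b] -> X r + l *: Y \in Lfun P 2%:E.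
    by move=> rab; apply: Lfun2D => //; exact: X2.
  have X'C r : r \in `[a, b] ->
      M (X r + l *: Y) (X r + l *: Y) <= C + 2 * l * c + l ^+ 2 * M Y Y.
    move=> rab; rewrite mixed_moment_sqrD ?X2// mixed_momentZZ// lerD2r lerD ?XC//.
    have -> : M (X r) (l *: Y) = l * M (X r) Y.
      by rewrite mixed_momentC mixed_momentZl ?X2// mixed_momentC.
    by rewrite -mulrnAl -[l *+ 2]mulr_natl ler_wpM2l ?mulr_ge0 ?XY.
  have JX' : {ae P, forall w,
      {within `[a, b], continuous (fun r => (X r + l *: Y) w)} /\
      (J + ((b - a) * l) *: Y) w =
        Rintegral lebesgue_measure `[a, b] (fun r => (X r + l *: Y) w)}.
    apply: filterS JX => w [cX JE]; split.
      by move=> r; apply: cvgD; [exact: cX|exact: cvg_cst].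
    have -> : (J + ((b - a) * l) *: Y) w = J w + (l * Y w) * (b - a).
      by have -> : (J + ((b - a) * l) *: Y) w = J w + (b - a) * l * Y w by []; ring.
    rewrite JE (RintegralD (f2 := cst (l * Y w)))//; last 2 first.
    - by apply: continuous_compact_integrable => //; exact: segment_compact.
    - apply: continuous_compact_integrable; first exact: segment_compact.
      by apply: continuous_subspaceT => r; exact: cvg_cst.
    by rewrite Rintegral_cst//= lebesgue_measure_itv/= lte_fin ab -EFinB.
  have := Rintegral_second_moment_le ab X'2 X'C JX' (Lfun2D J2 blY2).
  rewrite mixed_moment_sqrD// mixed_momentZZ// mixed_momentC mixed_momentZl//.
  rewrite [M Y J]mixed_momentC => H.
  rewrite -(ler_pM2l ba); have := mixed_moment_ge0 P J.
  by move: H; move: (M J J) (M J Y) (M Y Y) => u v z; nra.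
rewrite leNgt; apply/negP => lt_c.
pose e := M J Y - (b - a) * c.
have e0 : 0 < e by rewrite subr_gt0.
(* For this l, [key] reads 2 l e <= (b - a) C, contradicting l e = (b - a) C + 1 and C >= 0. *)
have l0 : 0 <= ((b - a) * C + 1) / e.
  by rewrite divr_ge0 ?ltW// ltr_wpDl// mulr_ge0// ltW.
have := key _ l0; set l := (_ / e) in l0 *.
have le : l * e = (b - a) * C + 1 by rewrite /l divfK// gt_eqF.
have bC : 0 <= (b - a) * C by rewrite mulr_ge0// ltW.
by rewrite /e in le; nra.
Qed.

End mean_square_integral.

(** * Covariances of Brownian increments *)

Section brownian_covariance.
Context {d : measure_display} {T : measurableType d} {R : realType}.
Variables (P : probability T R) (W : R -> {RV P >-> R}).
Hypothesis W_BM : standard_brownian_motion W.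
Local Notation M := (mixed_moment P).

Definition brownian_increment (s t : R) : T -> R := (W t : T -> R) - (W s : T -> R).
Local Notation D := brownian_increment.

Lemma brownian_incrementB s t r : D s t - D s r = D r t.
Proof. by apply/funext => w; rewrite /brownian_increment !fctE; ring. Qed.

Lemma brownian_increment_Lfun2 s t : 0 <= s -> s <= t -> D s t \in Lfun P 2%:E.
Proof.
move=> s0; rewrite le_eqVlt => /predU1P[<-|st].
  rewrite /brownian_increment subrr; apply/Lfun2P; split; first exact: measurable_cst.
  by under eq_integral do rewrite expr0n; rewrite integral0 ltry.
have [_ _ law _] := W_BM.
apply: (@normal_law_Lfun2 _ _ _ _ _ (Num.sqrt (t - s))).
- by rewrite gt_eqF// sqrtr_gt0 subr_gt0.
- exact: measurable_funB.
- by move=> B mB; exact: law.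
Qed.

Lemma brownian_increment_second_moment s t : 0 <= s -> s <= t ->
  M (D s t) (D s t) = t - s.
Proof.
move=> s0; rewrite le_eqVlt => /predU1P[<-|st].
  by rewrite /brownian_increment !subrr mixed_moment0l.
have [_ _ law _] := W_BM.
apply: EFin_inj; rewrite -second_momentE; last by apply: brownian_increment_Lfun2 => //; exact: ltW.
rewrite (@normal_law_second_moment _ _ _ _ _ (Num.sqrt (t - s))).
- by rewrite sqr_sqrtr// subr_ge0 ltW.
- by rewrite gt_eqF// sqrtr_gt0 subr_gt0.
- exact: measurable_funB.
- by move=> B mB; exact: law.
Qed.

(** Polarization: D s t - D s r = D r t, and all three second moments are known. *)
Lemma brownian_covariance s r t : 0 <= s -> s <= r -> r <= t ->
  M (D s r) (D s t) = r - s.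
Proof.
move=> s0 sr rt; have st := le_trans sr rt; have r0 := le_trans s0 sr.
have Dr2 := brownian_increment_Lfun2 s0 sr; have Dt2 := brownian_increment_Lfun2 s0 st.
have := mixed_moment_sqrB Dt2 Dr2.
rewrite brownian_incrementB !brownian_increment_second_moment// mixed_momentC.
by lra.
Qed.

(** D s t is the difference of D 0 t and D 0 s, and both have covariance r with D 0 r. *)
Lemma brownian_orthogonal_increments r s t : 0 <= r -> r <= s -> s <= t ->
  M (D 0 r) (D s t) = 0.
Proof.
move=> r0 rs st; have s0 := le_trans r0 rs; have t0 := le_trans s0 st.
rewrite -(brownian_incrementB 0 t s) mixed_momentC mixed_momentBl;
  [|exact: brownian_increment_Lfun2..].
rewrite mixed_momentC [M (D 0 s) _]mixed_momentC !brownian_covariance// ?subrr//.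
exact: le_trans st.
Qed.

(** Independence concerns the variables W_t, while the normal law concerns increments; W_0 = 0
    almost surely lets [D 0 t] and [W t] be exchanged. *)
Lemma independent_brownian_mixed_moment (X : {RV P >-> R}) t :
  (X : T -> R) \in Lfun P 2%:E -> indep_of P X (sigma_process W `[0, +oo[) ->
  0 <= t -> M X (D 0 t) = 0.
Proof.
move=> X2 iX; rewrite le_eqVlt => /predU1P[<-|t0].
  by rewrite /brownian_increment subrr mixed_momentC mixed_moment0l.
have [W0 _ law _] := W_BM.
have D2 := brownian_increment_Lfun2 (lexx 0) (ltW t0).
have DW : {ae P, forall w, D 0 t w = W t w}.
  apply: filterS W0 => w W0w.
    by have -> : D 0 t w = W t w - W 0 w by []; rewrite W0w subr0.
have W2 : (W t : T -> R) \in Lfun P 2%:E.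
  apply/Lfun2P; split => //; have [mD] := (Lfun2P _ _).1 D2; apply: le_lt_trans.
  apply: ae_ge0_le_integral => //.
  - by move=> w _; rewrite lee_fin sqr_ge0.
  - by apply/measurable_EFinP; exact: measurable_funX.
  - by move=> w _; rewrite lee_fin sqr_ge0.
  - by apply/measurable_EFinP; exact: measurable_funX.
  - by apply: filterS DW => w -> _.
rewrite mixed_momentC (ae_eq_mixed_moment D2 W2 X2 DW) mixed_momentC.
apply: independent_mixed_moment_eq0 => // [A B mA mB|].
  apply: iX => //; apply: sub_gen_smallest; exists t, B; split => //.
  by rewrite /= in_itv/= ltW.
rewrite -(@normal_law_mean _ _ _ P (D 0 t) (Num.sqrt (t - 0))); last 3 first.
- by rewrite gt_eqF// sqrtr_gt0 subr0.
- exact: measurable_funB.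
- by move=> B mB; exact: law.
apply: ae_eq_integral => //.
- exact/measurable_EFinP.
- by apply/measurable_EFinP; have [] := (Lfun2P _ _).1 D2.
- by apply: filterS DW => w /= -> _.
Qed.

End brownian_covariance.

(** * Noise part of the Ornstein-Uhlenbeck process and the lower bound on its second moment *)

Section ornstein_uhlenbeck_moments.
Context {d : measure_display} {T : measurableType d} {R : realType}.
Variables (P : probability T R) (W X : R -> {RV P >-> R}) (tau : R).
Hypotheses (tau0 : 0 < tau) (W_BM : standard_brownian_motion W).
Hypothesis X_OU : ornstein_uhlenbeck tau W X.
Local Notation M := (mixed_moment P).
Local Notation D := (brownian_increment W).
Local Notation mu := (@lebesgue_measure R).

(** The stochastic convolution tau^-1 int_s^t e^{-(t-r)/tau} dW_r, encoded by subtraction so that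
    X_t = e^{-(t-s)/tau} X_s + G holds identically and without a stochastic integral. *)
Definition ou_noise (s t : R) : T -> R :=
  (X t : T -> R) - expR ((s - t) / tau) *: (X s : T -> R).
Local Notation G := ou_noise.

(* Almost surely the time integral of e^{(r-t)/tau} (W_r - W_s) over [s, t]; this
   algebraic form makes its measurability immediate. *)
Definition ou_noise_integral (s t : R) : T -> R :=
  tau *: D s t - tau ^+ 2 *: G s t.
Local Notation J := ou_noise_integral.

Lemma ou_noise_integralE (s t : R) : 0 <= s -> s < t ->
  {ae P, forall w,
    {within `[s, t], continuous (fun r => (expR ((r - t) / tau) *: D s r) w)} /\
    J s t w = Rintegral mu `[s, t] (fun r => (expR ((r - t) / tau) *: D s r) w)}.
Proof.
move=> s0 st; have [_ _ _ cW] := W_BM; have [_ cX XE] := X_OU.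
have sub0 (u : R) : 0 <= u -> `[u, t] `<=` `[0, +oo[.
  move=> u0 r; rewrite /= !in_itv/= andbT => /andP[ur _]; exact: le_trans ur.
apply: filterS3 cW cX XE => w cWw cXw XEw.
have cWst := continuous_subspaceW (sub0 s s0) cWw.
have cXst := continuous_subspaceW (sub0 s s0) cXw.
have cE : continuous (fun r => expR ((r - t) / tau)).
  move=> r; apply: (cvg_comp (fun r => (r - t) / tau) expR); last exact: continuous_expR.
  apply: cvgMl; apply: cvgB; [exact: cvg_id|exact: cvg_cst].
split.
  move=> r; apply: cvgM; first exact: (continuous_subspaceT cE).
  by apply: cvgB; [exact: cWst|exact: cvg_cst].
(* Subtracting the integral equations at r and at s restarts the equation at time s. *)
have step (r : R) : r \in `[s, t] -> X r w = X s w
    - tau^-1 * Rintegral mu `[s, r] (fun u => X u w) + tau^-1 * (W r w - W s w).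
  rewrite in_itv/= => /andP[sr rt].
  have iX : mu.-integrable `[0, r] (EFin \o (fun u => X u w)).
    apply: continuous_compact_integrable; first exact: segment_compact.
    apply: continuous_subspaceW cXw => u; rewrite /= !in_itv/= andbT.
    by move=> /andP[].
  rewrite XEw; last exact: le_trans sr.
  rewrite [X s w]XEw//.
  have := Rintegral_itvB (a := BLeft 0) (b := BRight r) (x := s) iX.
  rewrite !bnd_simp => /(_ s0 sr).
  rewrite Rintegral_itv_obnd_cbnd; last first.
    apply: (integrableS _ _ _ iX) => //.
    by apply: subset_itvr; rewrite bnd_simp.
  by move=> <-; ring.
have := variation_of_constants (lt0r_neq0 tau0) st cXst cWst step.
have -> : J s t w = tau * (W t w - W s w)
    - tau ^+ 2 * (X t w - expR ((s - t) / tau) * X s w) by [].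
move=> ->.
have -> : Rintegral mu `[s, t] (fun r => (expR ((r - t) / tau) *: D s r) w) =
    Rintegral mu `[s, t] (fun r => expR ((r - t) / tau) * (W r w - W s w)) by [].
by field; rewrite lt0r_neq0.
Qed.

Let wD2 s t r : 0 <= s -> r \in `[s, t] -> expR ((r - t) / tau) *: D s r \in Lfun P 2%:E.
Proof.
by move=> s0; rewrite in_itv/= => /andP[sr _]; exact/Lfun2Z/brownian_increment_Lfun2.
Qed.

Let expR_decay_le1 (r t : R) : r <= t -> 0 <= expR ((r - t) / tau) <= 1.
Proof.
move=> rt; rewrite expR_ge0 -expR0 ler_expR.
by rewrite ler_pdivrMr// mul0r subr_le0.
Qed.

Let wD_le s t r : 0 <= s -> r \in `[s, t] ->
  M (expR ((r - t) / tau) *: D s r) (expR ((r - t) / tau) *: D s r) <= t - s.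
Proof.
move=> s0; rewrite in_itv/= => /andP[sr rt].
rewrite mixed_momentZZ ?brownian_increment_second_moment//; last first.
  exact: brownian_increment_Lfun2.
have /andP[e0 e1] := expR_decay_le1 rt.
have : expR ((r - t) / tau) ^+ 2 <= 1 by rewrite expr_le1.
by nra.
Qed.

Lemma ou_noiseE (s t : R) : G s t = tau^-1 *: D s t - tau ^- 2 *: J s t.
Proof.
apply/funext => w; rewrite /ou_noise_integral.
have -> : (tau^-1 *: D s t - tau ^- 2 *: (tau *: D s t - tau ^+ 2 *: G s t)) w =
  tau^-1 * D s t w - tau ^- 2 * (tau * D s t w - tau ^+ 2 * G s t w) by [].
by field; rewrite lt0r_neq0.
Qed.

Lemma measurable_ou_noise s t : measurable_fun setT (G s t).
Proof. by apply: measurable_funB => //; exact: measurable_funM. Qed.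

Lemma ou_noise_integral_Lfun2 s t : 0 <= s -> s < t -> J s t \in Lfun P 2%:E.
Proof.
move=> s0 st; apply: (Rintegral_Lfun2 (C := t - s) st _ _ (ou_noise_integralE s0 st)).
- by move=> r; exact: wD2.
- by move=> r; exact: wD_le.
apply: measurable_funB; first by apply: measurable_funM => //; exact: measurable_funB.
by apply: measurable_funM => //; exact: measurable_ou_noise.
Qed.

Lemma ou_noise_Lfun2 s t : 0 <= s -> s < t -> G s t \in Lfun P 2%:E.
Proof.
move=> s0 st; rewrite ou_noiseE; apply: Lfun2B; apply: Lfun2Z.
  by apply: brownian_increment_Lfun2 => //; exact: ltW.
exact: ou_noise_integral_Lfun2.
Qed.

(** Over one correlation time, D / tau and J / tau^2 each have second moment at most 1 / tau, and
    each is counted twice. *)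
Lemma ou_noise_second_moment_le s : 0 <= s ->
  M (G s (s + tau)) (G s (s + tau)) <= 4 / tau.
Proof.
move=> s0; have st : s < s + tau by rewrite ltrDl.
have D2 := brownian_increment_Lfun2 W_BM s0 (ltW st).
have J2 := ou_noise_integral_Lfun2 s0 st.
have JC : M (J s (s + tau)) (J s (s + tau)) <= tau ^+ 3.
  have -> : tau ^+ 3 = (s + tau - s) ^+ 2 * (s + tau - s) by ring.
  apply: (Rintegral_second_moment_le st _ _ (ou_noise_integralE s0 st) J2).
  - by move=> r; exact: wD2.
  - by move=> r; exact: wD_le.
rewrite ou_noiseE -scaleNr.
apply: le_trans (mixed_moment_sqrD_le (Lfun2Z _ D2) (Lfun2Z _ J2)) _.
rewrite !mixed_momentZZ// brownian_increment_second_moment//; last exact: ltW.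
have -> : s + tau - s = tau by ring.
have -> : 4 / tau = 2 * (tau^-1 ^+ 2 * tau) + 2 * ((- tau ^- 2) ^+ 2 * tau ^+ 3).
  by field; rewrite lt0r_neq0.
by rewrite lerD2l ler_pM2l// ler_wpM2l// sqr_ge0.
Qed.

(** J enters G with a minus sign, so an upper bound on its pairing bounds that of G below; c >= 0
    lets the exponential weight be replaced by 1. *)
Lemma ou_noise_mixed_moment_ge s t c (Y : T -> R) : 0 <= s -> s < t -> 0 <= c ->
  Y \in Lfun P 2%:E -> (forall r, r \in `[s, t] -> M (D s r) Y <= c) ->
  tau^-1 * M (D s t) Y - tau ^- 2 * ((t - s) * c) <= M (G s t) Y.
Proof.
move=> s0 st c0 Y2 DY.
have D2 := brownian_increment_Lfun2 W_BM s0 (ltW st).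
have J2 := ou_noise_integral_Lfun2 s0 st.
have aD2 := Lfun2Z tau^-1 D2; have aJ2 := Lfun2Z (tau ^- 2) J2.
rewrite ou_noiseE (mixed_momentBl aD2 aJ2 Y2) (mixed_momentZl _ D2 Y2).
rewrite (mixed_momentZl _ J2 Y2) lerD2l lerN2.
rewrite ler_pM2l ?invr_gt0 ?exprn_gt0//.
apply: (Rintegral_mixed_moment_le (C := t - s) st _ _ (ou_noise_integralE s0 st)) => //.
- by move=> r; exact: wD2.
- by move=> r; exact: wD_le.
move=> r rst; have /andP[sr rt] : s <= r <= t by move: rst; rewrite in_itv.
rewrite mixed_momentZl//; last exact: brownian_increment_Lfun2.
have /andP[e0 e1] := expR_decay_le1 rt.
apply: le_trans (ler_wpM2l e0 (DY r rst)) _.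
by rewrite ler_piMl.
Qed.

(** The preceding lower bound with c = 0, applied to both Y and - Y. *)
Lemma ou_noise_orthogonal s t (Y : T -> R) : 0 <= s -> s < t ->
  Y \in Lfun P 2%:E -> (forall r, r \in `[s, t] -> M (D s r) Y = 0) ->
  M (G s t) Y = 0.
Proof.
move=> s0 st Y2 DY; have G2 := ou_noise_Lfun2 s0 st.
have tst : t \in `[s, t] by rewrite in_itv/= lexx ltW.
have ge0 (Z : T -> R) : Z \in Lfun P 2%:E ->
    (forall r, r \in `[s, t] -> M (D s r) Z = 0) -> 0 <= M (G s t) Z.
  move=> Z2 DZ; have := @ou_noise_mixed_moment_ge s t 0 Z s0 st (lexx _) Z2.
  rewrite DZ// !mulr0 subr0; apply => r rst; by rewrite DZ.
have MN (Z : T -> R) : Z \in Lfun P 2%:E -> M Z (- Y) = - M Z Y.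
  by move=> Z2; rewrite mixed_momentC -scaleN1r mixed_momentZl// mulN1r mixed_momentC.
have := ge0 _ Y2 DY; have := ge0 _ (Lfun2N Y2).
rewrite MN// oppr_ge0 => le0 {}ge0; apply/eqP; rewrite eq_le ge0 andbT le0// => r rst.
rewrite MN ?DY ?oppr0//; move: rst; rewrite in_itv/= => /andP[sr _].
exact: brownian_increment_Lfun2.
Qed.

(* Pairing X_t with the last Brownian increment Y, of length tau / 2, kills the
   past, while the contribution of the noise is at least 1/2 - 1/4. *)
Lemma ou_second_moment_ge t : tau <= t ->
  (X t : T -> R) \in Lfun P 2%:E -> (8 * tau)^-1 <= M (X t) (X t).
Proof.
move=> taut Xt2.
have ht : tau / 2 < t by move: (tau0) taut; lra.
pose h := tau / 2; pose s := t - h.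
have h0 : 0 < h by rewrite divr_gt0.
have s0 : 0 < s by rewrite subr_gt0.
have st : s < t by rewrite gtrBl.
have ts : t - s = h by rewrite /s; ring.
have s0' := ltW s0; have st' := ltW st; have t0 := le_trans s0' st'.
have XE (u v : R) : (X v : T -> R) = expR ((u - v) / tau) *: (X u : T -> R) + G u v.
  by rewrite /ou_noise addrC subrK.
(* Inverting the decay carries square-integrability backwards in time, so X_s and X_0 inherit it
   from X_t. *)
have back (u v : R) : 0 <= u -> u < v -> (X v : T -> R) \in Lfun P 2%:E ->
    (X u : T -> R) \in Lfun P 2%:E.
  move=> u0 uv Xv2.
  have -> : (X u : T -> R) = (expR ((u - v) / tau))^-1 *: ((X v : T -> R) - G u v).
    by rewrite subKr scalerA mulVf ?scale1r// gt_eqF// expR_gt0.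
  by apply: Lfun2Z; apply: Lfun2B => //; exact: ou_noise_Lfun2.
have Xs2 := back _ _ (ltW s0) st Xt2; have X02 := back _ _ (lexx 0) s0 Xs2.
pose Y := D s t; have Y2 : Y \in Lfun P 2%:E.
  by apply: brownian_increment_Lfun2 => //; exact: ltW.
(* X_s combines X_0, orthogonal to Y by independence, and the noise up to time s, orthogonal to
   later increments. *)
have XsY : M (X s) Y = 0.
  have G02 := ou_noise_Lfun2 (lexx 0) s0.
  rewrite (XE 0 s) mixed_momentDl ?Lfun2Z// mixed_momentZl//.
  rewrite (ou_noise_orthogonal (lexx 0) s0 Y2) ?addr0; last first.
    move=> r; rewrite in_itv/= => /andP[r0 rs].
    by apply: brownian_orthogonal_increments => //; exact: ltW.
  have [iX _ _] := X_OU.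
  rewrite /Y -(brownian_incrementB _ 0 t s) mixed_momentC mixed_momentBl//; last 2 first.
    exact: brownian_increment_Lfun2.
    exact: brownian_increment_Lfun2.
  rewrite mixed_momentC [M (D 0 s) _]mixed_momentC.
  by rewrite !(independent_brownian_mixed_moment W_BM X02 iX) ?subrr ?mulr0.
have GY : 4^-1 <= M (G s t) Y.
  have := @ou_noise_mixed_moment_ge s t h Y (ltW s0) st (ltW h0) Y2.
  rewrite /Y brownian_increment_second_moment// ts.
  have -> : tau^-1 * h - tau ^- 2 * (h * h) = 4^-1 by rewrite /h; field; rewrite lt0r_neq0.
  apply => r; rewrite in_itv/= => /andP[sr rt].
  by rewrite brownian_covariance// -ts lerD2r.
have XtY : 4^-1 <= M (X t) Y.
  rewrite (XE s t) mixed_momentDl ?Lfun2Z ?ou_noise_Lfun2//.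
  by rewrite mixed_momentZl// XsY mulr0 add0r.
(* Subtracting l Y gives E X_t^2 >= l / 2 - l^2 tau / 2; the multiplier l = 1 / (2 tau) maximizes
   this, with value 1 / (8 tau). *)
have := mixed_moment_ge0 P ((X t : T -> R) - (2 * tau)^-1 *: Y).
have lY2 := Lfun2Z (2 * tau)^-1 Y2.
rewrite mixed_moment_sqrB// mixed_momentZZ// brownian_increment_second_moment// ts.
rewrite mixed_momentC mixed_momentZl// [M Y _]mixed_momentC.
have -> : (2 * tau)^-1 ^+ 2 * h = (8 * tau)^-1 by rewrite /h; field; rewrite lt0r_neq0.
have H : (2 * tau)^-1 * 4^-1 <= (2 * tau)^-1 * M (X t) Y.
  by rewrite ler_wpM2l// invr_ge0 mulr_ge0// ltW.
have E : (2 * tau)^-1 * 4^-1 = (8 * tau)^-1 by field; rewrite lt0r_neq0.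
by lra.
Qed.

End ornstein_uhlenbeck_moments.

(** * Upper bound on the stationary second moment *)

Section stationary_ornstein_uhlenbeck.
Context {d : measure_display} {T : measurableType d} {R : realType}.
Variables (P : probability T R) (W X : R -> {RV P >-> R}) (tau : R).
Hypotheses (tau0 : 0 < tau) (W_BM : standard_brownian_motion W).
Hypotheses (X_OU : ornstein_uhlenbeck tau W X) (X_st : stationary X).
Local Notation M := (mixed_moment P).
Local Notation G := (ou_noise X tau).

(** Stationarity for a single time, based at 0 and shifted by t, equates the laws of X_t and X_0. *)
Lemma ge0_integral_stationary (t : R) (f : R -> \bar R) : 0 <= t ->
  measurable_fun [set: R] f -> (forall x, 0 <= f x)%E ->
  (\int[P]_w f (X t w) = \int[P]_w f (X 0 w))%E.
Proof.
move=> t0 mf f0; rewrite -(ge0_integral_distribution (X t))//.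
rewrite -(ge0_integral_distribution (X 0))//.
apply: eq_measure_integral => A mA _; rewrite /distribution/= /pushforward.
have := X_st (k := 1) (t := fun=> 0) (B := fun=> A) t0 (fun=> lexx 0) (fun=> mA).
rewrite add0r.
have setE (Z : T -> R) : [set w | forall i : 'I_1, A (Z w)] = Z @^-1` A.
  by apply/seteqP; split => w /= => [/(_ ord0)|Aw _].
by rewrite !setE.
Qed.

(** The decay over one correlation time. *)
Let a := expR (- 1 : R).

Let a_bounds : 0 < a <= 2^-1.
Proof.
rewrite /a expR_gt0/= expRN lef_pV2 ?posrE ?expR_gt0//.
by have := expR_ge1Dx (1 : R); rewrite -[1 + 1]/(2%:R).
Qed.

Let H (n : nat) : T -> R := (X (n%:R * tau) : T -> R) - a ^+ n *: (X 0 : T -> R).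

Let HS n : H n.+1 = a *: H n + G (n%:R * tau) (n%:R * tau + tau).
Proof.
apply/funext => w; rewrite /H /ou_noise.
have -> : n.+1%:R * tau = n%:R * tau + tau by rewrite -natr1; ring.
have -> : (n%:R * tau - (n%:R * tau + tau)) / tau = -1 by field; rewrite lt0r_neq0.
rewrite -/a.
have E (u v x : R) : u - a ^+ n.+1 * x = a * (v - a ^+ n * x) + (u - a * v).
  by rewrite exprS; ring.
exact: E.
Qed.

(** Since a^2 <= 1/4, the recursion bounds the next moment by v / 2 + 8 / tau, whose fixed point is
    16 / tau. *)
Let H_bound n : H n \in Lfun P 2%:E /\ M (H n) (H n) <= 16 / tau.
Proof.
elim: n => [|n [H2 HM]].
  have -> : H 0 = 0 by rewrite /H mul0r expr0 scale1r subrr.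
  split; last by rewrite mixed_moment0l divr_ge0// ltW.
  apply/Lfun2P; split; first exact: measurable_cst.
  by under eq_integral do rewrite expr0n; rewrite integral0 ltry.
have nt0 : 0 <= n%:R * tau by rewrite mulr_ge0// ltW.
have G2 : G (n%:R * tau) (n%:R * tau + tau) \in Lfun P 2%:E.
  by apply: (ou_noise_Lfun2 tau0 W_BM X_OU) => //; rewrite ltrDl.
have GM := ou_noise_second_moment_le tau0 W_BM X_OU nt0.
rewrite HS; split; first by apply: Lfun2D => //; exact: Lfun2Z.
apply: le_trans (mixed_moment_sqrD_le (Lfun2Z a H2) G2) _.
rewrite mixed_momentZZ//.
have /andP[a0 a1] := a_bounds.
have a2 : a ^+ 2 <= 4^-1 by move: a0 a1; move: (a) => b; nra.
have -> : 16 / tau = 2 * (4^-1 * (16 / tau)) + 2 * (4 / tau).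
  by field; rewrite lt0r_neq0.
rewrite lerD ?ler_pM2l// ler_pM ?sqr_ge0// mixed_moment_ge0.
by [].
Qed.

(** Truncation keeps every quantity finite before E X_0^2 is known to be. By stationarity X_0 may be
    replaced by X_{n tau}; its decayed part vanishes by dominated convergence and its noise part
    costs 2 * 16 / tau. *)
Let truncated (L : R) : 0 < L ->
  (\int[P]_w (Num.min (X 0 w ^+ 2) L)%:E <= (32 / tau)%:E)%E.
Proof.
move=> L0.
have mmin (c : R) (Y : {RV P >-> R}) :
    measurable_fun setT (fun w => (Num.min ((c * Y w) ^+ 2) L)%:E).
  apply/measurable_EFinP; apply: measurable_minr => //.
  by apply: measurable_funX; exact: measurable_funM.
have min0 (x : R) : 0 <= Num.min (x ^+ 2) L by rewrite le_min sqr_ge0 ltW.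
have bound n : (\int[P]_w (Num.min (X 0 w ^+ 2) L)%:E <=
    2%:E * \int[P]_w (Num.min ((a ^+ n * X 0 w) ^+ 2) L)%:E + (32 / tau)%:E)%E.
  have [H2 HM] := H_bound n; have [mH _] := (Lfun2P _ _).1 H2.
  rewrite -(@ge0_integral_stationary (n%:R * tau)
    (fun x => (Num.min (x ^+ 2) L)%:E)); last 3 first.
  - by rewrite mulr_ge0// ltW.
  - apply/measurable_EFinP; apply: measurable_minr => //; exact: exprn_measurable.
  - by move=> x; rewrite lee_fin.
  have -> : (32 / tau)%:E = (2%:E * (16 / tau)%:E)%E.
    by rewrite -EFinM; congr EFin; rewrite mulrA -natrM.
  pose F w := (Num.min ((a ^+ n * X 0 w) ^+ 2) L)%:E.
  pose K w := (H n w ^+ 2)%:E.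
  have mF : measurable_fun setT F := mmin (a ^+ n) (X 0).
  have mK : measurable_fun setT K by apply/measurable_EFinP; exact: measurable_funX.
  have F0 w : setT w -> (0 <= F w)%E by rewrite lee_fin.
  have K0 w : setT w -> (0 <= K w)%E by rewrite lee_fin sqr_ge0.
  apply: (@le_trans _ _ (2%:E * \int[P]_w F w + 2%:E * \int[P]_w K w)%E); last first.
    by rewrite leeD2l// lee_pmul2l// second_moment_le.
  rewrite -(ge0_integralZl P measurableT mF F0)// -(ge0_integralZl P measurableT mK K0)//.
  have m2F := measurable_funeM 2%:E mF; have m2K := measurable_funeM 2%:E mK.
  rewrite -(ge0_integralD P measurableT _ m2F _ m2K)//; last 2 first.
  - by move=> w _; rewrite mule_ge0// F0.
  - by move=> w _; rewrite mule_ge0// K0.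
  apply: ge0_le_integral => //.
  - by move=> w _; rewrite lee_fin.
  - have := mmin 1 (X (n%:R * tau)); apply: eq_measurable_fun => w _.
    by rewrite mul1r.
  - exact: emeasurable_funD.
  move=> w _; rewrite -!EFinM -EFinD lee_fin.
  have -> : X (n%:R * tau) w = a ^+ n * X 0 w + H n w.
    by rewrite -[H n w]/(X (n%:R * tau) w - a ^+ n * X 0 w); ring.
  move: (a ^+ n * X 0 w) (H n w) => x y.
  have xy : (x + y) ^+ 2 <= 2 * x ^+ 2 + 2 * y ^+ 2.
    by have := sqr_ge0 (x - y); rewrite sqrrB sqrrD; lra.
  have y0 := sqr_ge0 y.
  (* If the decayed part is itself truncated, its contribution 2 L already exceeds the left side,
     which is at most L. *)
  have [xL|Lx] := leP (x ^+ 2) L; first by rewrite (le_trans _ xy)// ge_min lexx.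
  by rewrite (@le_trans _ _ L) ?ge_min ?lexx ?orbT//; move: L0 y0; lra.
have cvg0 : (\int[P]_w (Num.min ((a ^+ n * X 0 w) ^+ 2) L)%:E @[n --> \oo] --> 0)%E.
  have := @dominated_cvg _ _ _ P setT measurableT
    (fun n w => (Num.min ((a ^+ n * X 0 w) ^+ 2) L)%:E) (cst 0%E) (cst L%:E).
  rewrite integral0; apply => //.
  - move=> w _; apply: cvg_EFin; first exact: nearW.
    have cmin : continuous (fun x : R => Num.min ((x * X 0 w) ^+ 2) L).
      move: (X 0 w : R) => y x.
      apply: (@continuous_min _ _ (fun x : R => (x * y) ^+ 2) (cst L)); last exact: cvg_cst.
      apply: (cvg_comp (fun x => x * y) (fun x : R => x ^+ 2)); last exact: sqr_continuous.
      by apply: cvgMl; exact: cvg_id.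
    have cva : a ^+ n @[n --> \oo] --> (0 : R).
      apply: cvg_expr; have /andP[a0 a1] := a_bounds.
      by rewrite ger0_norm ?(le_lt_trans a1)// ?invf_lt1 ?ltr1n// ltW.
    have min00 : Num.min ((0 * X 0 w) ^+ 2) L = 0.
      by rewrite mul0r expr0n/= min_l// ltW.
    by have := cvg_comp _ _ cva (cmin 0); rewrite min00.
  - by apply/integrableP; split => //; rewrite integral_cst//= probability_setT mule1 ltry.
  - by move=> n w _ /=; rewrite ger0_norm// lee_fin ge_min lexx orbT.
have lim : (2%:E * \int[P]_w (Num.min ((a ^+ n * X 0 w) ^+ 2) L)%:E + (32 / tau)%:E
    @[n --> \oo] --> 2%:E * 0 + (32 / tau)%:E)%E.
  by apply: cvgeD => //; [exact: cvgeZl|exact: cvg_cst].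
rewrite mule0 add0e in lim.
rewrite -(cvg_lim _ lim)//; apply: lime_ge; first by apply/cvg_ex; exists (32 / tau)%:E.
exact: nearW.
Qed.

Lemma stationary_ou_second_moment_le t : 0 <= t ->
  (\int[P]_w (X t w ^+ 2)%:E <= (32 / tau)%:E)%E.
Proof.
move=> t0; rewrite (ge0_integral_stationary (f := fun x => (x ^+ 2)%:E))//; last 2 first.
- by apply/measurable_EFinP; exact: exprn_measurable.
- by move=> x; rewrite lee_fin sqr_ge0.
(* The bound does not depend on the level. Level n + 1 stays positive, as [truncated] requires, and
   at each w the truncation is eventually inactive. *)
apply: (@ae_fatou_le _ _ _ P (fun n w => (Num.min (X 0 w ^+ 2) n.+1%:R)%:E)).
- move=> n; apply/measurable_EFinP; apply: measurable_minr => //.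
  exact: measurable_funX.
- by apply/measurable_EFinP; exact: measurable_funX.
- by move=> n w; rewrite lee_fin le_min sqr_ge0 ler0n.
- by move=> w; rewrite lee_fin sqr_ge0.
- apply: aeW => w; apply: cvg_near_cst; near=> n; congr EFin; apply/min_idPl.
  apply: (@le_trans _ _ n%:R); last by rewrite ler_nat.
  by near: n; exact: nbhs_infty_ger.
- by move=> n; exact: truncated.
Unshelve. all: end_near. Qed.

End stationary_ornstein_uhlenbeck.

(** * Comparison of integrals under a measurable majorant *)

Section nonmeasurable_comparison.
Context {d : measure_display} {T : measurableType d} {R : realType}.
Variable P : probability T R.
Import HBNNSimple.

(* [f] need not be measurable: its integral is a supremum over simple functions
   below [f]. *)
Lemma ae_ge0_le_integral_nonmeasurable (f g : T -> \bar R) :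
  (forall w, 0 <= f w)%E -> (forall w, 0 <= g w)%E -> measurable_fun setT g ->
  {ae P, forall w, (f w <= g w)%E} -> (\int[P]_w f w <= \int[P]_w g w)%E.
Proof.
move=> f0 g0 mg fg; rewrite ge0_integralTE//.
apply: ge_ereal_sup => _ [h /= hf <-]; rewrite -integralT_nnsfun.
apply: ae_ge0_le_integral => //.
- by move=> w _; rewrite lee_fin.
- exact/measurable_EFinP.
by apply: filterS fg => w fgw _; exact: le_trans (hf w) fgw.
Qed.

End nonmeasurable_comparison.

(** * Displacement error and kinetic energy *)

Section energy.
Context {R : realType}.

Lemma sqnormZ n (c : R) (u : 'rV[R]_n) : sqnorm (c *: u) = c ^+ 2 * sqnorm u.
Proof.
by rewrite /sqnorm mulr_sumr; apply: eq_bigr => i _; rewrite mxE exprMn.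
Qed.

Lemma sqnorm_ge0 n (u : 'rV[R]_n) : 0 <= sqnorm u.
Proof. by apply: sumr_ge0 => i _; exact: sqr_ge0. Qed.

Lemma sqnorm_gt0 n (u : 'rV[R]_n) : u != 0 -> 0 < sqnorm u.
Proof.
move=> u0; rewrite lt0r sqnorm_ge0 andbT; apply: contra_neq u0 => u0.
apply/rowP => i; rewrite mxE; apply/eqP; rewrite -sqrf_eq0.
by move/eqP: u0; rewrite psumr_eq0 => [/allP/(_ i (mem_index_enum _))|j _] //; exact: sqr_ge0.
Qed.

Context {d : measure_display} {T : measurableType d} {P : probability T R}.
Variables (n : nat) (rho : R) (alpha : 'rV[R]_n).
Variables (W : R -> {RV P >-> R}) (xi : R -> R -> {RV P >-> R}).
Hypotheses (rho_gt0 : 0 < rho) (W_BM : standard_brownian_motion W).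
Hypothesis xi_OU : forall tau : R, 0 < tau -> ornstein_uhlenbeck tau W (xi tau).
Let q := unresolved_velocity alpha xi.
Let at_stationarity := forall tau : R, 0 < tau -> stationary (xi tau).

(** The integral equation is solved for the time integral of xi, and W_0 = 0 almost surely. *)
Lemma integrated_velocityE (tau t : R) : 0 < tau -> 0 <= t ->
  {ae P, forall w, integrated_velocity q tau t w - brownian_displacement alpha W t w =
    (- (tau * (xi tau t w - xi tau 0 w))) *: alpha}.
Proof.
move=> tau0 t0; have [W0 _ _ _] := W_BM; have [_ cX XE] := xi_OU tau0.
apply: filterS3 W0 cX XE => w W0w cXw XEw.
apply/rowP => i; rewrite !mxE /q /unresolved_velocity.
have -> : (fun s => (xi tau s w *: alpha) 0 i) = (fun s => xi tau s w * alpha 0 i).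
  by apply/funext => s; rewrite mxE.
rewrite RintegralZr//; last first.
  apply: continuous_compact_integrable; first exact: segment_compact.
  apply: continuous_subspaceW cXw => s; rewrite /= !in_itv/= andbT.
  by move=> /andP[].
rewrite (XEw _ t0) W0w.
by field; rewrite lt0r_neq0.
Qed.

(** Each of xi_t and xi_0 has second moment at most 32 / tau, so tau^2 times that of their
    difference is at most 128 tau. *)
Lemma displacement_error_le (tau t : R) : 0 < tau -> 0 <= t -> stationary (xi tau) ->
  ('E_P[fun w => sqnorm (integrated_velocity q tau t w
     - brownian_displacement alpha W t w)%R] <= (128 * sqnorm alpha * tau)%:E)%E.
Proof.
move=> tau0 t0 st; pose X := xi tau.
have X2 s : 0 <= s -> (X s : T -> R) \in Lfun P 2%:E.
  move=> s0; apply/Lfun2P; split => //.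
  exact: le_lt_trans (stationary_ou_second_moment_le tau0 W_BM (xi_OU tau0) st s0) (ltry _).
have XM s : 0 <= s -> mixed_moment P (X s) (X s) <= 32 / tau.
  move=> s0; rewrite -(second_moment_le _ (X2 s s0)).
  exact: (stationary_ou_second_moment_le tau0 W_BM (xi_OU tau0) st s0).
pose Y : T -> R := tau *: ((X t : T -> R) - (X 0 : T -> R)).
have XtX0 := Lfun2B (X2 t t0) (X2 0 (lexx 0)).
have Y2 : Y \in Lfun P 2%:E by exact: Lfun2Z.
have YM : mixed_moment P Y Y <= 128 * tau.
  rewrite mixed_momentZZ//.
  have -> : 128 * tau = tau ^+ 2 * (128 / tau) by field; rewrite lt0r_neq0.
  rewrite ler_pM2l ?exprn_gt0//.
  have := mixed_moment_sqrD_le (X2 t t0) (Lfun2N (X2 0 (lexx 0))).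
  move=> /le_trans; apply.
  have -> : mixed_moment P (- (X 0 : T -> R)) (- (X 0 : T -> R)) = mixed_moment P (X 0) (X 0).
    by rewrite -scaleN1r mixed_momentZZ ?X2// sqrrN expr1n mul1r.
  have := XM t t0; have := XM 0 (lexx 0).
  have -> : 128 / tau = 4 * (32 / tau) by rewrite mulrA -natrM.
  by lra.
have [mY _] := (Lfun2P _ _).1 Y2.
rewrite unlock.
(* Measurability in w of the pathwise time integral is not assumed; it suffices that the error
   agrees almost surely with a measurable function. *)
apply: (@le_trans _ _ (\int[P]_w ((sqnorm alpha)%:E * (Y w ^+ 2)%:E))%E).
  apply: ae_ge0_le_integral_nonmeasurable => //.
  - by move=> w; rewrite lee_fin sqnorm_ge0.
  - by move=> w; rewrite -EFinM lee_fin mulr_ge0 ?sqr_ge0 ?sqnorm_ge0.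
  - by apply: measurable_funeM; apply/measurable_EFinP; exact: measurable_funX.
  apply: filterS (integrated_velocityE tau0 t0) => w ->.
  by rewrite -EFinM lee_fin sqnormZ sqrrN mulrC.
rewrite ge0_integralZl//; last 3 first.
- by apply/measurable_EFinP; exact: measurable_funX.
- by move=> w _; rewrite lee_fin sqr_ge0.
- by rewrite lee_fin sqnorm_ge0.
rewrite second_momentE// -EFinM lee_fin -mulrA mulrCA.
by rewrite ler_wpM2l ?sqnorm_ge0.
Qed.

Lemma kinetic_energy_ge (tau t : R) : 0 < tau -> tau <= t ->
  ((rho * sqnorm alpha / 16 / tau)%:E <= kinetic_energy P rho q tau t)%E.
Proof.
move=> tau0 taut; rewrite /kinetic_energy unlock.
have c0 : 0 <= rho * sqnorm alpha / 2.
  by rewrite divr_ge0// mulr_ge0 ?sqnorm_ge0// ltW.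
have -> : (\int[P]_w (rho * sqnorm (q tau t w) / 2)%:E =
    \int[P]_w ((rho * sqnorm alpha / 2)%:E * (xi tau t w ^+ 2)%:E))%E.
  by apply: eq_integral => w _; rewrite -EFinM sqnormZ; congr EFin; ring.
rewrite ge0_integralZl//; last 2 first.
- by apply/measurable_EFinP; exact: measurable_funX.
- by move=> w _; rewrite lee_fin sqr_ge0.
have -> : rho * sqnorm alpha / 16 / tau = rho * sqnorm alpha / 2 * (8 * tau)^-1.
  by field; rewrite lt0r_neq0.
rewrite EFinM lee_wpmul2l ?lee_fin//.
(* An infinite second moment satisfies the bound trivially; otherwise xi_t is in L2 and the lower
   bound 1 / (8 tau) applies. *)
have [Xoo|Xoo] := ltP (\int[P]_w (xi tau t w ^+ 2)%:E)%E +oo%E; last first.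
  exact: le_trans (leey _) Xoo.
have X2 : (xi tau t : T -> R) \in Lfun P 2%:E by apply/Lfun2P.
rewrite second_momentE// lee_fin.
exact: (ou_second_moment_ge tau0 W_BM (xi_OU tau0)).
Qed.

Lemma kinetic_energy_stationary (tau s t : R) : 0 <= s -> 0 <= t ->
  stationary (xi tau) -> kinetic_energy P rho q tau s = kinetic_energy P rho q tau t.
Proof.
move=> s0 t0 st; rewrite /kinetic_energy unlock.
pose f (x : R) := (rho * (x ^+ 2 * sqnorm alpha) / 2)%:E.
have E r : 0 <= r -> (\int[P]_w (rho * sqnorm (q tau r w) / 2)%:E = \int[P]_w f (xi tau 0 w))%E.
  move=> r0; rewrite -(ge0_integral_stationary st r0 (f := f)).
  - by apply: eq_integral => w _; rewrite sqnormZ.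
  - apply/measurable_EFinP; apply: measurable_funM => //; apply: measurable_funM => //.
    by apply: measurable_funM => //; exact: exprn_measurable.
  - move=> x; have rho_ge0 := ltW rho_gt0.
    by rewrite lee_fin divr_ge0// mulr_ge0// mulr_ge0 ?sqr_ge0 ?sqnorm_ge0.
by rewrite !E.
Qed.

(** The energy bound c / tau requires tau <= t. This holds eventually when t > 0; at stationarity
    the energy is evaluated at time tau instead, which also covers t = 0. *)
Lemma kinetic_energy_cvg (t : R) : alpha != 0 -> 0 <= t -> at_stationarity \/ 0 < t ->
  kinetic_energy P rho q tau t @[tau --> (0 : R)^'+] --> +oo%E.
Proof.
move=> alpha0 t0 tst; apply/cvgeyPge => A.
have c0 : 0 < rho * sqnorm alpha / 16 by rewrite divr_gt0// mulr_gt0// sqnorm_gt0.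
have small : \forall tau \near (0 : R)^'+, 0 < t -> tau <= t.
  have [t_gt0|_] := ltP 0 t; last exact: nearW.
  by apply: filterS (nbhs_right_le t_gt0) => tau.
near=> tau.
have tau_le : 0 < t -> tau <= t by near: tau.
have tau0 : 0 < tau by near: tau; exact: nbhs_right_gt.
apply: (@le_trans _ _ (rho * sqnorm alpha / 16 / tau)%:E).
  rewrite lee_fin ler_pdivlMr//.
  (* Replacing A by |A| + 1 > 0 makes the threshold c / (|A| + 1) for tau positive, whatever the
     sign of A. *)
  apply: (@le_trans _ _ ((`|A| + 1) * tau)).
    by rewrite ler_pM2r// (le_trans (ler_norm _))// lerDl.
  rewrite mulrC -ler_pdivlMr ?ltr_wpDl//.
  by near: tau; apply: nbhs_right_le; rewrite divr_gt0// ltr_wpDl.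
case: tst => [st|t_gt0].
  rewrite (kinetic_energy_stationary t0 (ltW tau0) (st _ tau0)).
  exact: kinetic_energy_ge.
by apply: kinetic_energy_ge => //; exact: tau_le.
Unshelve. all: end_near. Qed.

End energy.

(** * The displacement limit, the incompatibility and the divergence of the energy *)

Unset Implicit Arguments.

Theorem theorem6p1 (R : realType) (d : measure_display) (T : measurableType d)
    (P : probability T R) (n : nat) (rho : R) (alpha : 'rV[R]_n)
    (W : R -> {RV P >-> R}) (xi : R -> R -> {RV P >-> R})
    (rho_gt0 : 0 < rho)
    (W_BM : standard_brownian_motion W)
    (xi_OU : forall tau : R, 0 < tau -> ornstein_uhlenbeck tau W (xi tau)) :
  let q := unresolved_velocity alpha xi in
  let at_stationarity := forall tau : R, 0 < tau -> stationary (xi tau) in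
  [/\ at_stationarity -> brownian_displacement_limit alpha W q,
      forall t : R, 0 <= t -> at_stationarity \/ 0 < t ->
        ~ [/\ brownian_displacement_limit alpha W q,
              nonzero_brownian_displacement alpha W
            & finite_energy_limit P rho q t]
    & alpha != 0 ->
      forall t : R, 0 <= t -> at_stationarity \/ 0 < t ->
        kinetic_energy P rho q tau t @[tau --> (0 : R)^'+] --> +oo%E].
Proof.
move=> q at_stationarity.
have energy := @kinetic_energy_cvg R d T P n rho alpha W xi rho_gt0 W_BM xi_OU.
split.
- move=> st t t0.
  have cvgl : ((128 * sqnorm alpha * tau)%:E @[tau --> (0 : R)^'+] --> 0%:E)%E.
    apply: cvg_EFin; first exact: nearW.
    have cl : continuous (fun x : R => 128 * sqnorm alpha * x).
      by move=> x; apply: cvgMr; exact: cvg_id.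
    by have := cvg_at_right_filter (cl 0); rewrite mulr0.
  apply: (squeeze_cvge _ (cvg_cst 0%:E) cvgl).
  near=> tau; have tau0 : 0 < tau by near: tau; exact: nbhs_right_gt.
  apply/andP; split; first by apply: expectation_ge0 => w; exact: sqnorm_ge0.
  exact: (displacement_error_le alpha W_BM xi_OU tau0 t0 (st _ tau0)).
- move=> t t0 tst [_ [s s0 nz] [M Mub]].
  (* A zero volatility would make every displacement vanish identically. *)
  have alpha0 : alpha != 0.
    apply/eqP => alpha0; apply: nz; apply: aeW => w.
    by rewrite /brownian_displacement alpha0 scaler0.
  (* Near 0 the energy is at once at most M and at least M + 1; a single tau satisfying both gives
     the contradiction. *)
  have /cvgeyPge/(_ (M + 1)) Mlb := energy t alpha0 t0 tst.
  have [tau [le_M ge_M]] := @filter_ex _ (0 : R)^'+ _ _ (filterI Mub Mlb).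
  by have := le_trans ge_M le_M; rewrite lee_fin gerDl ler10.
- by move=> alpha0 t t0 tst; exact: energy.
Unshelve. all: end_near. Qed.
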